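(* Let $\mathcal{Z}=\mathcal{S}(\{Z_1,\ldots,Z_r\})$ be an involutive distribution of rank $r<n$ on an open set $U\subseteq\mathbb{R}^n$. (1) If $X$ is a $\mathcal{C}^{\infty}$-symmetry of $\mathcal{Z}$, then there exist a symmetry $Y$ of $\mathcal{Z}$ and a function $h$ such that $X=hY$. (2) For a $\mathcal{C}^{\infty}$-symmetry $X$ of $\mathcal{Z}$, with $[X,Z_i]=\lambda_iX+\sum_{k=1}^r c_{ik}Z_k$ for $i=1,\ldots,r$, the corresponding system $Z_i(f)=\lambda_i f$, $i=1,\ldots,r$, for the unknown function $f$ is compatible. (3) Let $X$ be a $\mathcal{C}^{\infty}$-symmetry of $\mathcal{Z}$ with a given symmetrizing factor $f$. A function $\widetilde f$ is a symmetrizing factor of $X$ with respect to $\mathcal{Z}$ if and only if $\widetilde f=fg$ for some first integral $g$ of the distribution $\mathcal{Z}$.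
   Context: Vector fields are called independent on $U$ if they are pointwise linearly independent at every point of $U$. $\mathcal{S}(B)$ denotes the $\mathcal{C}^\infty(U)$-submodule of the module of smooth vector fields on $U$ generated by $B$. A rank $r$ distribution on $U$ is a submodule $\mathcal{S}(\{Z_1,\ldots,Z_r\})$ with $Z_1,\ldots,Z_r$ independent vector fields on $U$; it is involutive if it is closed under the Lie bracket. A vector field $X$ on $U$ such that $\{Z_1,\ldots,Z_r,X\}$ is independent on $U$ is a $\mathcal{C}^{\infty}$-symmetry of the involutive distribution $\mathcal{Z}=\mathcal{S}(\{Z_1,\ldots,Z_r\})$ if $\mathcal{S}(\{Z_1,\ldots,Z_r,X\})$ is involutive, i.e. there are smooth functions $\lambda_i,c_{ik}$ on $U$ with $[X,Z_i]=\lambda_iX+\sum_{k=1}^r c_{ik}Z_k$ for $1\le i\le r$. It is a symmetry of $\mathcal{Z}$ in the particular case where all $\lambda_i=0$. A symmetrizing factor of a $\mathcal{C}^{\infty}$-symmetry $X$ with respect to $\mathcal{Z}$ is a non-vanishing smooth function $f$ such that $fX$ is a symmetry of $\mathcal{Z}$ (equivalently, $Z_i(f)=\lambda_i f$ for $i=1,\ldots,r$). A first integral of $\mathcal{Z}$ is a function $g$ with $Z_i(g)=0$ for $i=1,\ldots,r$.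
   Formalization: Parts (1) and (2) are stated near each point of U (globally (1) fails, e.g. on an annulus), with ''compatible'' meaning that a smooth non-vanishing solution exists near every point; in (3) the first integral g is required to be non-vanishing on U. *)

(* Defs.v *)
From HB Require Import structures.
From mathcomp Require Import all_boot all_order all_algebra.
From mathcomp Require Import all_classical all_reals all_analysis.

Set Implicit Arguments.
Unset Strict Implicit.
Unset Printing Implicit Defensive.

Import Order.TTheory GRing.Theory Num.Theory.
Import numFieldNormedType.Exports.

Local Open Scope classical_set_scope.
Local Open Scope ring_scope.

(* Functions and vector fields on an open set U are represented by total maps
   on 'rV[R]_n; every notion below depends only on their values on U, because
   derivatives at a point of an open set are local. A vector field is given by
   its components in the standard coordinates. *)

Section VectorFields.
Context {R : realType} {n : nat}.
Implicit Types (U : set 'rV[R]_n) (f g : 'rV[R]_n -> R)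
  (X Y V W : 'rV[R]_n -> 'rV[R]_n).

Fixpoint Ck_on {E : normedModType R} (k : nat) U (F : 'rV[R]_n -> E) : Prop :=
  (forall x, U x -> {for x, continuous F}) /\
  match k with
  | 0%N => True
  | k'.+1 => forall i : 'I_n,
      (forall x, U x -> derivable F x (delta_mx 0 i)) /\
      Ck_on k' U ('D_(delta_mx 0 i) F)
  end.

Definition smooth_on {E : normedModType R} U (F : 'rV[R]_n -> E) : Prop :=
  forall k, Ck_on k U F.

Definition nonvanishing_on U f : Prop := forall x, U x -> f x != 0.

Definition vf_app X f : 'rV[R]_n -> R := fun x => 'D_(X x) f x.

(* The components of [X, Y] are X(Y^j) - Y(X^j), so that
   [X, Y](f) = X(Y(f)) - Y(X(f)). *)
Definition lie_bracket X Y : 'rV[R]_n -> 'rV[R]_n :=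
  fun x => 'D_(X x) Y x - 'D_(Y x) X x.

Definition independent_on U {r : nat}
    (Z : 'I_r -> 'rV[R]_n -> 'rV[R]_n) : Prop :=
  forall x, U x -> row_free (\matrix_(i < r) Z i x).

(* Membership in the C^oo(U)-module S({Z_1, ..., Z_r}). *)
Definition in_module U {r : nat} (Z : 'I_r -> 'rV[R]_n -> 'rV[R]_n) V : Prop :=
  exists c : 'I_r -> 'rV[R]_n -> R,
    (forall i, smooth_on U (c i)) /\
    (forall x, U x -> V x = \sum_(i < r) c i x *: Z i x).

Definition involutive_on U {r : nat}
    (Z : 'I_r -> 'rV[R]_n -> 'rV[R]_n) : Prop :=
  forall V W, in_module U Z V -> in_module U Z W ->
    in_module U Z (lie_bracket V W).

Definition involutive_distribution U {r : nat}
    (Z : 'I_r -> 'rV[R]_n -> 'rV[R]_n) : Prop :=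
  [/\ forall i, smooth_on U (Z i), independent_on U Z & involutive_on U Z].

Definition adjoin {r : nat} (Z : 'I_r -> 'rV[R]_n -> 'rV[R]_n) X :
    'I_r.+1 -> 'rV[R]_n -> 'rV[R]_n :=
  fun i => if unlift ord_max i is Some j then Z j else X.

Definition Coo_symmetry U {r : nat}
    (Z : 'I_r -> 'rV[R]_n -> 'rV[R]_n) X : Prop :=
  [/\ smooth_on U X, independent_on U (adjoin Z X)
    & involutive_on U (adjoin Z X)].

Definition bracket_relations U {r : nat} (Z : 'I_r -> 'rV[R]_n -> 'rV[R]_n) X
    (lam : 'I_r -> 'rV[R]_n -> R) (c : 'I_r -> 'I_r -> 'rV[R]_n -> R) : Prop :=
  [/\ forall i, smooth_on U (lam i),
      forall i k, smooth_on U (c i k)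
    & forall i x, U x ->
        lie_bracket X (Z i) x = lam i x *: X x + \sum_(k < r) c i k x *: Z k x].

Definition is_symmetry U {r : nat}
    (Z : 'I_r -> 'rV[R]_n -> 'rV[R]_n) X : Prop :=
  Coo_symmetry U Z X /\
  exists c : 'I_r -> 'I_r -> 'rV[R]_n -> R,
    bracket_relations U Z X (fun _ _ => 0) c.

Definition symmetrizing_factor U {r : nat}
    (Z : 'I_r -> 'rV[R]_n -> 'rV[R]_n) X f : Prop :=
  [/\ smooth_on U f, nonvanishing_on U f
    & is_symmetry U Z (fun x => f x *: X x)].

Definition first_integral U {r : nat}
    (Z : 'I_r -> 'rV[R]_n -> 'rV[R]_n) g : Prop :=
  smooth_on U g /\ forall i x, U x -> vf_app (Z i) g x = 0.

(* Compatibility of the overdetermined system Z_i(f) = lam_i f: it has a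
   solution near every point of U. The solution must not vanish, since f = 0
   always solves the system. Solvability is local: Z = d/dt + (s - 1) d/ds
   and X = d/ds in polar coordinates (s, t) on an annulus containing the circle
   s = 1 satisfy [X, Z] = X, but no nonvanishing f on the whole annulus satisfies
   Z(f) = f, as this would give f(1, 2 pi) = exp (2 pi) f(1, 0). *)
Definition compatible_on U {r : nat} (Z : 'I_r -> 'rV[R]_n -> 'rV[R]_n)
    (lam : 'I_r -> 'rV[R]_n -> R) : Prop :=
  forall p, U p -> exists V : set 'rV[R]_n,
    [/\ open V, V p, V `<=` U
      & exists f, [/\ smooth_on V f, nonvanishing_on V f
          & forall i x, V x -> vf_app (Z i) f x = lam i x * f x]].

End VectorFields.

(* Main.v *)
(* If Z_i(w) = 0 for all i, then Z_i(X(w)) = X(Z_i(w)) - [X, Z_i](w) =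
   - lam_i X(w), so f = 1 / X(w) is a local nonvanishing solution of the system
   Z_i(f) = lam_i f as soon as X(w) does not vanish; then f X is a symmetry and
   X = (1 / f) (f X). Two symmetrizing factors solve the same linear system, so
   their quotient is a first integral.
   A first integral w with X(w) <> 0 at p is obtained as in the proof of
   Frobenius' theorem. After inverting a block of the matrix of the Z_i one may
   assume that Z_i has components delta_ij on r of the coordinates; involutivity
   then forces [Z_i, Z_j] = 0. Starting from one of the remaining coordinate
   functions, compose successively with the projections onto the slices
   x_i = p_i along the flow of Z_i: since the fields commute and are tangent to
   the other slices, each step keeps the equations already gained.
   Flows come from Picard iteration. They are C^k in all variables by induction
   on k, the derivative of a flow being the solution of the first variation
   equation, an equation of the same type. *)
From HB Require Import structures.
Require Import Defs.
From mathcomp Require Import all_boot all_order all_algebra.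
From mathcomp Require Import all_classical all_reals all_analysis.
From mathcomp Require Import ring lra.
Import Order.TTheory GRing.Theory Num.Theory.
Import numFieldNormedType.Exports.
Local Open Scope classical_set_scope.
Local Open Scope ring_scope.

Set Implicit Arguments.
Unset Strict Implicit.
Unset Printing Implicit Defensive.

(** [Ck_on] only speaks of continuous iterated partial derivatives, so differentiability, the chain
    rule and the symmetry of second derivatives have to be won from continuity of the partials. The
    projection step needs no commuting flows. If Z(w') = 0 and [Z, Y] = 0, then Z(Y(w')) = Y(Z(w'))
    = 0, so Y(w') is constant along the flow lines of Z; at the foot of the line on the slice it
    equals Y(w), because Y is tangent to the slice and w' = w there. The coordinate function to
    start from is read off X(p). Subtract from X(p) the combination of normalized frame vectors with
    the same [sigma]-coordinates: the remainder v is tangent to the slice through p where these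
    coordinates are frozen, and v is nonzero by independence, say v_a <> 0. The first integral w
    grown from x_a agrees with x_a on that slice, hence X(w)(p) = v(w)(p) = v_a. *)

Local Notation "''e_' i" := (delta_mx 0 i) (at level 8, i at level 2, format "''e_' i").

(** * Functions with continuous partial derivatives *)

Section RowNorm.
Context {R : realType}.

Lemma le_entry_norm m n (A : 'M[R]_(m, n)) i j : `|A i j| <= `|A|.
Proof.
rewrite [leRHS]/Num.Def.normr/= mx_normrE.
exact: (le_bigmax _ (fun ij => `|A ij.1 ij.2|) (i, j)).
Qed.

Lemma le_coord_norm n (h : 'rV[R]_n) j : `|h 0 j| <= `|h|.
Proof. exact: le_entry_norm. Qed.

Lemma norm_rV_le n (h : 'rV[R]_n) (M : R) :
  0 <= M -> (forall j, `|h 0 j| <= M) -> `|h| <= M.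
Proof.
move=> M0 hM; rewrite [leLHS]/Num.Def.normr/= mx_normrE.
by apply/bigmax_leP; split => // -[i j] _ /=; rewrite ord1.
Qed.

Lemma norm_rV_lt n (h : 'rV[R]_n) (M : R) :
  0 < M -> (forall j, `|h 0 j| < M) -> `|h| < M.
Proof.
move=> M0 hM; rewrite [ltLHS]/Num.Def.normr/= mx_normrE.
by apply/bigmax_ltP; split => // -[i j] _ /=; rewrite ord1.
Qed.

Lemma norm_delta_le n (i : 'I_n) : `|'e_i : 'rV[R]_n| <= 1.
Proof.
apply: norm_rV_le => // j; rewrite mxE eqxx/=.
by case: eqP => _; rewrite ?normr1 // normr0.
Qed.

End RowNorm.

Section Lines.
Context {R : realType}.

Lemma is_derive_line (V W : normedModType R) (f : V -> W) (a v : V) (t : R) :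
  derivable f (t *: v + a) v ->
  is_derive t 1 (fun s : R => f (s *: v + a)) ('D_v f (t *: v + a)).
Proof.
move=> df; have E :
    (fun h : R => h^-1 *: (((fun s : R => f (s *: v + a)) \o shift t) (h *: (1 : R))
       - f (t *: v + a)))
   = (fun h : R => h^-1 *: ((f \o shift (t *: v + a)) (h *: v) - f (t *: v + a))).
  apply/funext => h /=; congr (_ *: (f _ - _)).
  by rewrite [h *: 1]mulr1 scalerDl addrA.
apply: DeriveDef; rewrite /derivable /derive E //.
Qed.

Lemma is_derive_continuous (W : normedModType R) (g : R -> W) (t : R) (dg : W) :
  is_derive t 1 g dg -> {for t, continuous g}.
Proof. by case=> /derivable1_diffP/differentiable_continuous. Qed.

(** The sign condition [0 <= t * c] keeps the intermediate point on the side of [c]. Later bounds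
    are in terms of [|t|], whose derivative changes sign at 0, so they need to know the side. *)
Lemma MVT_sym (g g' : R -> R) (c : R) :
  (forall t : R, `|t| <= `|c| -> is_derive t 1 g (g' t)) ->
  exists2 t : R, `|t| <= `|c| /\ 0 <= t * c & g c - g 0 = g' t * c.
Proof.
move=> dg; have [c0|c0] := leP 0 c.
  have [||t] := @MVT_segment _ g g' 0 c c0.
  - move=> x; rewrite in_itv/= => /andP[x0 xc]; apply: dg.
    by rewrite !ger0_norm// ltW.
  - apply: continuous_in_subspaceT => x; rewrite inE/= in_itv/= => /andP[x0 xc].
    by apply: (is_derive_continuous (dg _ _)); rewrite !ger0_norm.
  rewrite in_itv/= => /andP[t0 tc]; rewrite subr0 => E; exists t => //.
  by split; [rewrite !ger0_norm|exact: mulr_ge0].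
have [||t] := @MVT_segment _ g g' c 0 (ltW c0).
- move=> x; rewrite in_itv/= => /andP[x0 xc]; apply: dg.
  by rewrite !ler0_norm ?lerN2 ?ltW.
- apply: continuous_in_subspaceT => x; rewrite inE/= in_itv/= => /andP[x0 xc].
  by apply: (is_derive_continuous (dg _ _)); rewrite (ler0_norm xc) (ltr0_norm c0) lerN2.
rewrite in_itv/= => /andP[t0 tc]; rewrite sub0r => E; exists t.
  split; first by rewrite (ler0_norm tc) (ltr0_norm c0) lerN2.
  by apply: mulr_le0 => //; exact: ltW.
by rewrite -opprB E mulrN opprK.
Qed.

Lemma MVT_line (V : normedModType R) (f : V -> R) (a v : V) (c : R) :
  (forall t : R, `|t| <= `|c| -> derivable f (t *: v + a) v) ->
  exists2 t : R, `|t| <= `|c| & f (c *: v + a) - f a = 'D_v f (t *: v + a) * c.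
Proof.
move=> df.
have [t [tc _] E] := @MVT_sym (fun s => f (s *: v + a)) (fun t => 'D_v f (t *: v + a)) c
  (fun t tc => is_derive_line (df t tc)).
by exists t => //; rewrite -E scale0r add0r.
Qed.

End Lines.

Section Differentiability.
Context {R : realType}.

Lemma cvg_sumr (V : normedModType R) (T I : Type) (F : set_system T)
    {FF : Filter F} (r : seq I) (f : I -> T -> V) (l : I -> V) :
  (forall i, f i x @[x --> F] --> l i) ->
  \sum_(i <- r) f i x @[x --> F] --> \sum_(i <- r) l i.
Proof.
by move=> fl; apply: (cvg_big (P := xpredT) (@add_continuous V)) => i _.
Qed.

Definition lin_form n (d : 'I_n -> R) (v : 'rV[R]_n) : R := \sum_i v 0 i * d i.

Fact lin_form_is_linear n (d : 'I_n -> R) : linear (lin_form d).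
Proof.
move=> k u v; rewrite /lin_form scaler_sumr -big_split/=.
by apply: eq_bigr => i _; rewrite !mxE mulrDl -[_ *: _]/(_ * _) mulrA.
Qed.

HB.instance Definition _ n (d : 'I_n -> R) :=
  GRing.isLinear.Build R 'rV[R]_n R _ (lin_form d) (lin_form_is_linear d).

Lemma continuous_lin_form n (d : 'I_n -> R) : continuous (lin_form d).
Proof.
move=> x; rewrite /lin_form; apply: (@cvg_sumr _ _ _ (nbhs x)) => i.
by apply: cvgM; [exact: coord_continuous|exact: cvg_cst].
Qed.

Lemma is_diff_of_expansion (V W : normedModType R) (f : V -> W)
    (g : {linear V -> W}) (x : V) :
  continuous g ->
  (forall e : R, 0 < e -> \forall h \near (0 : V),
     `|f (h + x) - f x - g h| <= e * `|h|) ->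
  is_diff x f g.
Proof.
move=> gc H.
have E : f \o shift x = cst (f x) + g +o_ (nbhs 0) id.
  apply/eqaddoP => e e0; near=> h => /=.
  rewrite -[X in `|X|]/(f (h + x) - (f x + g h)) opprD addrA.
  by near: h; exact: H.
have D : 'd f x = g :> (V -> W) by exact: diff_unique.
by apply: DiffDef => //; apply/diff_locallyP; rewrite D.
Unshelve. all: by end_near. Qed.

Lemma near_forall (T : topologicalType) (I : finType) (P : I -> T -> Prop)
    (x : T) :
  (forall i, \forall y \near x, P i y) -> \forall y \near x, forall i, P i y.
Proof. by move=> H; exact: filter_forall. Qed.

Lemma nbhs0_normP (V : normedModType R) (x : V) (P : set V) :
  (\forall y \near x, P y) <->
  exists2 d : R, 0 < d & forall y, `|y - x| < d -> P y.
Proof.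
split=> [/nbhs_ballP[d d0 H]|[d d0 H]].
  by exists d => // y yx; apply: H; rewrite -ball_normE/= distrC.
by apply/nbhs_ballP; exists d => // y; rewrite -ball_normE/= distrC => /H.
Qed.

(** Go from [x] to [h + x] by changing one coordinate at a time; on each segment the mean value
    theorem gives a partial derivative at a nearby point, which is close to the one at [x] by
    continuity. *)
Lemma is_diff_of_partials n (f : 'rV[R]_n -> R) x :
  (forall i, \forall y \near x, derivable f y 'e_i) ->
  (forall i, {for x, continuous ('D_('e_i) f)}) ->
  is_diff x f (lin_form (fun i => 'D_('e_i) f x)).
Proof.
move=> df cf; apply: (is_diff_of_expansion (@continuous_lin_form _ _)) => e e0.
have n0 : (0 : R) < n.+1%:R by [].
have : \forall y \near x, forall i, derivable f y 'e_i /\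
    `|'D_('e_i) f x - 'D_('e_i) f y| <= e / n.+1%:R.
  apply: near_forall => i.
  near=> y; split; first by near: y; exact: df.
  by near: y; apply: (cvgrPdist_le _ _).1 (cf i) _ _; exact: divr_gt0.
move=> /nbhs0_normP[d d0 Hd]; apply/nbhs0_normP; exists d => // h.
rewrite subr0 => hd.
(* [p k] keeps the first [k] coordinates of [h], so consecutive points differ along a single
   axis. *)
pose p k : 'rV[R]_n := \row_j (if (j < k)%N then h 0 j else 0).
have p0 : p 0%N = 0 by apply/rowP => j; rewrite !mxE.
have pn : p n = h by apply/rowP => j; rewrite !mxE ltn_ord.
have pS (k : 'I_n) : p k.+1 = h 0 k *: 'e_k + p k.
  apply/rowP => j; rewrite !mxE eqxx/= ltnS leq_eqVlt.
  case: (eqVneq j k) => [->|jk]; rewrite ?eqxx ?ltnn/= ?mulr1 ?addr0//.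
  by rewrite val_eqE (negbTE jk)/= mulr0 add0r.
have T : f (h + x) - f x = \sum_(k < n) (f (p k.+1 + x) - f (p k + x)).
  rewrite -(big_mkord xpredT (fun k => f (p k.+1 + x) - f (p k + x))).
  by rewrite telescope_sumr// pn p0 add0r.
rewrite T /lin_form -sumrB; apply: le_trans (ler_norm_sum _ _ _) _.
apply: (@le_trans _ _ (\sum_(k < n) e / n.+1%:R * `|h|)); last first.
  rewrite -mulr_suml ler_wpM2r// sumr_const card_ord -[leLHS]mulr_natl mulrA.
  by rewrite ler_pdivrMr// mulrC; apply: ler_wpM2l; [exact: ltW|rewrite ler_nat].
apply: ler_sum => k _.
have near_p (t : R) : `|t| <= `|h 0 k| -> `|t *: 'e_k + (p k + x) - x| < d.
  move=> th; rewrite addrA addrK; apply: le_lt_trans hd.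
  apply: norm_rV_le => // j; rewrite !mxE eqxx/=.
  case: (eqVneq j k) => [->|jk]; rewrite ?ltnn ?mulr1 ?addr0 ?mulr0 ?add0r.
    by apply: le_trans th _; exact: le_coord_norm.
  by case: ifP => _; rewrite ?normr0//; exact: le_coord_norm.
have [t th] := @MVT_line _ _ f (p k + x) 'e_k (h 0 k)
  (fun t th => (Hd _ (near_p t th) k).1).
rewrite addrA -pS => ->; rewrite [h 0 k * _]mulrC -mulrBl normrM.
apply: ler_pM => //; last exact: le_coord_norm.
by rewrite distrC; exact: (Hd _ (near_p t th) k).2.
Unshelve. all: by end_near. Qed.

End Differentiability.

Section PartialDerivatives.
Context {R : realType}.

Lemma derive_lin_form n (f : 'rV[R]_n -> R) x (d : 'I_n -> R) v :
  is_diff x f (lin_form d) -> 'D_v f x = \sum_i v 0 i * d i.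
Proof. by case=> df E; rewrite deriveE// E. Qed.

Lemma Ck_onW k n (E : normedModType R) U (F : 'rV[R]_n -> E) :
  Ck_on k.+1 U F -> Ck_on k U F.
Proof.
elim: k F => [F []//|k IH F [cF dF]]; split => // i.
by have [dFi CFi] := dF i; split => //; exact: IH.
Qed.

Lemma Ck_on_sub k n (E : normedModType R) U V (F : 'rV[R]_n -> E) :
  V `<=` U -> Ck_on k U F -> Ck_on k V F.
Proof.
move=> VU; elim: k F => [F [cF _]|k IH F [cF dF]]; split => //.
- by move=> x /VU; exact: cF.
- by move=> x /VU; exact: cF.
move=> i; have [dFi CFi] := dF i; split; last exact: IH.
by move=> x /VU; exact: dFi.
Qed.

Lemma near_open (T : topologicalType) (U : set T) (P : T -> Prop) x :
  open U -> U x -> (forall y, U y -> P y) -> \forall y \near x, P y.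
Proof.
by move=> oU Ux UP; apply: (filterS UP); exact: open_nbhs_nbhs.
Qed.

Lemma near_eq_continuous (T S : topologicalType) (F G : T -> S) x :
  (\forall y \near x, F y = G y) -> {for x, continuous F} ->
  {for x, continuous G}.
Proof.
move=> FG cF; have E : F x = G x := nbhs_singleton FG.
suff : F y @[y --> x] --> G x by move=> H; exact: cvg_trans (near_eq_cvg FG) H.
by rewrite -E.
Qed.

Lemma Ck_on_eq k n (E : normedModType R) U (F G : 'rV[R]_n -> E) :
  open U -> (forall x, U x -> F x = G x) -> Ck_on k U F -> Ck_on k U G.
Proof.
move=> oU; elim: k F G => [F G FG [cF _]|k IH F G FG [cF dF]]; split => //.
- by move=> x Ux; apply: near_eq_continuous (cF _ Ux); exact: near_open oU Ux _.
- by move=> x Ux; apply: near_eq_continuous (cF _ Ux); exact: near_open oU Ux _.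
move=> i; have [dFi CFi] := dF i; split.
  by move=> x Ux; apply: near_eq_derivable (dFi _ Ux); exact: near_open oU Ux _.
by apply: IH CFi => x Ux; apply: near_eq_derive; exact: near_open oU Ux _.
Qed.

Lemma Ck_on_is_diff n U (f : 'rV[R]_n -> R) x :
  open U -> Ck_on 1 U f -> U x ->
  is_diff x f (lin_form (fun i => 'D_('e_i) f x)).
Proof.
move=> oU [_ H] Ux; apply: is_diff_of_partials => i.
  by apply: near_open oU Ux _; exact: (H i).1.
exact: (H i).2.1.
Qed.

Lemma Ck_on_differentiable n U (f : 'rV[R]_n -> R) x :
  open U -> Ck_on 1 U f -> U x -> differentiable f x.
Proof. by move=> oU H Ux; have [] := Ck_on_is_diff oU H Ux. Qed.

Lemma Ck_on_derive n U (f : 'rV[R]_n -> R) x v :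
  open U -> Ck_on 1 U f -> U x -> 'D_v f x = \sum_i v 0 i * 'D_('e_i) f x.
Proof. by move=> oU H Ux; rewrite (derive_lin_form _ (Ck_on_is_diff oU H Ux)). Qed.

Lemma differentiable_rV (V : normedModType R) m (G : V -> 'rV[R]_m) x :
  (forall j, differentiable (fun y => G y 0 j) x) -> differentiable G x.
Proof.
move=> dG.
have -> : G = \sum_j (fun y => G y 0 j *: 'e_j).
  by apply/funext => y; rewrite [LHS]row_sum_delta fct_sumE.
by apply: differentiable_sum => j; apply: differentiableZl.
Qed.

Lemma derive_comp (V : normedModType R) m (f : 'rV[R]_m -> R)
    (G : V -> 'rV[R]_m) x v :
  differentiable f (G x) -> (forall j, differentiable (fun y => G y 0 j) x) ->
  'D_v (fun y => f (G y)) x =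
    \sum_j 'D_v (fun y => G y 0 j) x * 'D_('e_j) f (G x).
Proof.
move=> df dG; have dGx := differentiable_rV dG.
have E : 'D_v (fun y => f (G y)) x = 'd f (G x) ('d G x v).
  by rewrite deriveE; [rewrite diff_comp|exact: differentiable_comp].
have {}E : 'D_v (fun y => f (G y)) x = 'd f (G x) ('D_v G x).
  by rewrite E [in RHS]deriveE.
rewrite E derive_mx; last exact: diff_derivable.
rewrite [X in 'd f _ X]row_sum_delta linear_sum; apply: eq_bigr => j _.
by rewrite linearZ/= mxE -deriveE.
Qed.

End PartialDerivatives.

(** * Symmetry of second derivatives, algebra and composition of C^k functions *)

Section SmoothCalculus.
Context {R : realType}.

Lemma translate_is_derive (V W : normedModType R) (f : V -> W) a x v :
  derivable f (a + x) v ->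
  is_derive x v (fun y => f (a + y)) ('D_v f (a + x)).
Proof.
move=> df; have E :
    (fun h : R => h^-1 *: (((fun y => f (a + y)) \o shift x) (h *: v) - f (a + x)))
   = (fun h : R => h^-1 *: ((f \o shift (a + x)) (h *: v) - f (a + x))).
  by apply/funext => h /=; rewrite addrCA.
by apply: DeriveDef; rewrite /derivable /derive E.
Qed.

(** The mean value theorem is used twice: along [e_i] for the increment of [f] under translation by
    [h *: 'e_j], then along [e_j] for the partial derivative so obtained. *)
Lemma second_difference n (f : 'rV[R]_n -> R) (x : 'rV[R]_n) i j (h : R) :
  (forall y, `|y - x| <= `|h| + `|h| ->
     derivable f y 'e_i /\ derivable ('D_('e_i) f) y 'e_j) ->
  exists2 y, `|y - x| <= `|h| + `|h| &
    f (h *: 'e_i + h *: 'e_j + x) - f (h *: 'e_i + x) - f (h *: 'e_j + x) + f x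
    = 'D_('e_j) ('D_('e_i) f) y * h * h.
Proof.
move=> H.
have nrm (s t : R) : `|s| <= `|h| -> `|t| <= `|h| ->
    `|s *: 'e_i + t *: 'e_j : 'rV[R]_n| <= `|h| + `|h|.
  move=> sh th; apply: le_trans (ler_normD _ _) _; rewrite !normrZ.
  apply: lerD; apply: le_trans (ler_wpM2l _ (norm_delta_le _)) _ => //;
  by rewrite mulr1.
have b1 s : `|s| <= `|h| -> `|(h *: 'e_j + (s *: 'e_i + x)) - x| <= `|h| + `|h|.
  by move=> sh; rewrite addrA addrK addrC nrm.
have b2 s : `|s| <= `|h| -> `|(s *: 'e_i + x) - x| <= `|h| + `|h|.
  by move=> sh; rewrite addrK -[_ *: _]addr0 -(scale0r 'e_j) nrm// normr0.
have dF s (sh : `|s| <= `|h|) :=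
  is_deriveB (translate_is_derive (H _ (b1 _ sh)).1) (derivableP (H _ (b2 _ sh)).1).
have [s sh Es] := @MVT_line _ _ ((fun y => f (h *: 'e_j + y)) - f) x 'e_i h
  (fun s sh => @ex_derive _ _ _ _ _ _ _ (dF s sh)).
rewrite (@derive_val _ _ _ _ _ _ _ (dF s sh)) in Es.
have b3 t : `|t| <= `|h| -> `|(t *: 'e_j + (s *: 'e_i + x)) - x| <= `|h| + `|h|.
  by move=> th; rewrite addrA addrK addrC nrm.
have [t th Et] := @MVT_line _ _ ('D_('e_i) f) (s *: 'e_i + x) 'e_j h
  (fun t th => (H _ (b3 _ th)).2).
exists (t *: 'e_j + (s *: 'e_i + x)); first exact: b3.
rewrite -Et -Es /= -![(_ - _ : _ -> _) _]/(_ - _).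
rewrite [h *: 'e_i + _]addrC -addrA opprB addrACA -!addrA; congr (_ + _).
by rewrite [f x - _]addrC addrCA.
Qed.

(** The second difference is symmetric in [i] and [j], so the two mixed derivatives agree at two
    points near [x]; by continuity they then agree at [x] up to any [e]. *)
Lemma derive_commute n U (f : 'rV[R]_n -> R) x i j :
  open U -> Ck_on 2 U f -> U x ->
  'D_('e_i) ('D_('e_j) f) x = 'D_('e_j) ('D_('e_i) f) x.
Proof.
move=> oU C2 Ux; apply/eqP; rewrite -subr_eq0 -normr_le0.
have dist_half (a b c e : R) : `|a - c| <= e / 2 -> `|b - c| <= e / 2 -> `|a - b| <= e.
  move=> ac bc; rewrite [e]splitr -(subrKA c) .
  by apply: le_trans (ler_normD _ _) (lerD ac _); rewrite distrC.
have E0 (a b c d' : R) : a - b - c + d' = a - c - b + d' by rewrite [a - b - c]addrAC.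
apply/ler_addgt0Pl => e e0; rewrite addr0.
pose P k l y := U y /\ `|'D_('e_k) ('D_('e_l) f) x - 'D_('e_k) ('D_('e_l) f) y| <= e / 2.
have nP k l : \forall y \near x, P k l y.
  near=> y; split; first by near: y; exact: open_nbhs_nbhs.
  near: y; apply: (cvgrPdist_le _ _).1; last by rewrite divr_gt0.
  have [_ /(_ l)[_ [_ /(_ k)[_ [cD _]]]]] := C2; exact: cD.
have /nbhs0_normP[d d0 Hd] : \forall y \near x, P i j y /\ P j i y.
  by apply: filterI; exact: nP.
(* A third, so that [|h| + |h|], the reach of the second difference, stays below [d]. *)
pose h := d / 3; have h0 : 0 < h by rewrite divr_gt0.
have hd y : `|y - x| <= `|h| + `|h| -> P i j y /\ P j i y.
  move=> yx; apply: Hd; apply: le_lt_trans yx _.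
  rewrite ger0_norm ?ltW// -[X in _ < X](mulfVK (_ : 3 != 0 :> R))// -/h.
  by rewrite mulr_natr !mulrS mulr0n addr0 ltrD2l ltrDl.
have dd k l y : `|y - x| <= `|h| + `|h| ->
    derivable f y 'e_k /\ derivable ('D_('e_k) f) y 'e_l.
  move=> /hd[[Uy _] _]; have [_ /(_ k)[dk [_ /(_ l)[dl _]]]] := C2.
  by split; [exact: dk|exact: dl].
have [y1 y1x E1] := @second_difference _ f x i j h (dd i j).
have [y2 y2x E2] := @second_difference _ f x j i h (dd j i).
have E : 'D_('e_j) ('D_('e_i) f) y1 = 'D_('e_i) ('D_('e_j) f) y2.
  apply: (mulIf (lt0r_neq0 h0)); apply: (mulIf (lt0r_neq0 h0)).
  by apply: etrans (esym E1) (etrans _ E2); rewrite [h *: 'e_j + h *: 'e_i]addrC E0.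
have [_ [_ H1]] := hd _ y1x; have [[_ H2] _] := hd _ y2x.
by apply: dist_half H2 _; rewrite -E.
Unshelve. all: by end_near. Qed.

Lemma continuous_cst_for (T S : topologicalType) (c : S) (x : T) :
  {for x, continuous (fun _ : T => c)}.
Proof. exact: cvg_cst. Qed.

Lemma Ck_on_cst k n (E : normedModType R) U (c : E) :
  Ck_on k U (fun _ : 'rV[R]_n => c).
Proof.
elim: k c => [|k IH] c; split => //; try (by move=> x _; exact: continuous_cst_for).
move=> i; split; first by move=> x _; exact: derivable_cst.
have -> : 'D_('e_i) (fun _ : 'rV[R]_n => c) = fun _ => 0.
  by apply/funext => x; rewrite derive_cst.
exact: IH.
Qed.

Lemma is_derive_coord n (j : 'I_n) (x v : 'rV[R]_n) :
  is_derive x v (fun y : 'rV[R]_n => y 0 j) (v 0 j).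
Proof.
have d : derivable (@id 'rV[R]_n) x v by exact: derivable_id.
apply: DeriveDef; first exact: (derivable_mxP _ _ _).1 d 0 j.
by have := derive_mx d; rewrite derive_id => /matrixP/(_ 0 j); rewrite mxE.
Qed.

Lemma Ck_on_coord k n U (j : 'I_n) : Ck_on k U (fun y : 'rV[R]_n => y 0 j).
Proof.
case: k => [|k]; split => //; try (by move=> x _; exact: coord_continuous).
move=> i; split; first by move=> x _; have [] := is_derive_coord j x 'e_i.
have -> : 'D_('e_i) (fun y : 'rV[R]_n => y 0 j) = fun _ => ('e_i : 'rV[R]_n) 0 j.
  by apply/funext => x; have [_ ->] := is_derive_coord j x 'e_i.
exact: Ck_on_cst.
Qed.

Lemma Ck_onD k n (E : normedModType R) U (f g : 'rV[R]_n -> E) :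
  open U -> Ck_on k U f -> Ck_on k U g -> Ck_on k U (fun x => f x + g x).
Proof.
move=> oU; elim: k f g => [|k IH] f g [cf df] [cg dg]; split => //;
  try (by move=> x Ux; exact: (continuousD (cf _ Ux) (cg _ Ux))).
move=> i; have [dfi Cfi] := df i; have [dgi Cgi] := dg i; split.
  by move=> x Ux; apply: derivableD; [exact: dfi|exact: dgi].
apply: Ck_on_eq (IH _ _ Cfi Cgi) => // x Ux.
by rewrite -deriveD//; [exact: dfi|exact: dgi].
Qed.

Lemma Ck_onM k n U (f g : 'rV[R]_n -> R) :
  open U -> Ck_on k U f -> Ck_on k U g -> Ck_on k U (fun x => f x * g x).
Proof.
move=> oU; elim: k f g => [|k IH] f g.
  move=> [cf _] [cg _]; split => // x Ux.
  by exact: (continuousM (cf _ Ux) (cg _ Ux)).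
move=> Cf Cg; have Cf' := Ck_onW Cf; have Cg' := Ck_onW Cg.
move: Cf Cg => [cf df] [cg dg]; split.
  by move=> x Ux; exact: (continuousM (cf _ Ux) (cg _ Ux)).
move=> i; have [dfi Cfi] := df i; have [dgi Cgi] := dg i; split.
  by move=> x Ux; apply: derivableM; [exact: dfi|exact: dgi].
apply: (Ck_on_eq oU _ (Ck_onD oU (IH _ _ Cf' Cgi) (IH _ _ Cg' Cfi))) => x Ux.
by rewrite -[RHS]/('D_('e_i) (f * g) x) deriveM//; [exact: dfi|exact: dgi].
Qed.

Lemma Ck_onN k n U (f : 'rV[R]_n -> R) :
  open U -> Ck_on k U f -> Ck_on k U (fun x => - f x).
Proof.
move=> oU Cf.
apply: (Ck_on_eq oU _ (Ck_onM oU (Ck_on_cst k U (-1 : R)) Cf)) => x _.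
by rewrite mulN1r.
Qed.

Lemma Ck_onV k n U (f : 'rV[R]_n -> R) :
  open U -> (forall x, U x -> f x != 0) -> Ck_on k U f ->
  Ck_on k U (fun x => (f x)^-1).
Proof.
move=> oU f0; elim: k => [|k IH].
  by move=> [cf _]; split => // x Ux; exact: (continuousV (f0 _ Ux) (cf _ Ux)).
move=> Cf; have Cf' := IH (Ck_onW Cf); move: Cf => [cf df]; split.
  by move=> x Ux; exact: (continuousV (f0 _ Ux) (cf _ Ux)).
move=> i; have [dfi Cfi] := df i; split.
  by move=> x Ux; apply: derivableV; [exact: f0|exact: dfi].
apply: (Ck_on_eq oU _ (Ck_onN oU (Ck_onM oU (Ck_onM oU Cf' Cf') Cfi))) => x Ux.
rewrite deriveV//; [|exact: f0|exact: dfi].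
by rewrite expr2 -mulrN invfM -[_ *: _]/(_ * _) mulNr mulrN.
Qed.

Lemma Ck_on_sum k n U (I : Type) (s : seq I) (P : pred I) (f : I -> 'rV[R]_n -> R) :
  open U -> (forall i, Ck_on k U (f i)) ->
  Ck_on k U (fun x => \sum_(i <- s | P i) f i x).
Proof.
move=> oU Cf; elim: s => [|i s IH].
  by apply: (Ck_on_eq oU _ (Ck_on_cst k U (0 : R))) => x _; rewrite big_nil.
case Pi : (P i); last by apply: (Ck_on_eq oU _ IH) => x _; rewrite big_cons Pi.
by apply: (Ck_on_eq oU _ (Ck_onD oU (Cf i) IH)) => x _; rewrite big_cons Pi.
Qed.

Lemma Ck_on_prod k n U (I : Type) (s : seq I) (P : pred I) (f : I -> 'rV[R]_n -> R) :
  open U -> (forall i, Ck_on k U (f i)) ->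
  Ck_on k U (fun x => \prod_(i <- s | P i) f i x).
Proof.
move=> oU Cf; elim: s => [|i s IH].
  by apply: (Ck_on_eq oU _ (Ck_on_cst k U (1 : R))) => x _; rewrite big_nil.
case Pi : (P i); last by apply: (Ck_on_eq oU _ IH) => x _; rewrite big_cons Pi.
by apply: (Ck_on_eq oU _ (Ck_onM oU (Cf i) IH)) => x _; rewrite big_cons Pi.
Qed.

Lemma continuous_rV (T : topologicalType) m (G : T -> 'rV[R]_m) x :
  (forall j, {for x, continuous (fun y => G y 0 j)}) -> {for x, continuous G}.
Proof.
move=> cG; apply/cvgrPdist_le => e e0.
have : \forall y \near x, forall j, `|G x 0 j - G y 0 j| <= e.
  by apply: near_forall => j; exact: (cvgrPdist_le _ _).1 (cG j) _ e0.
apply: filterS => y H; apply: norm_rV_le; first exact: ltW.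
by move=> j; rewrite !mxE; exact: H.
Qed.

Lemma continuous_coord (T : topologicalType) m (G : T -> 'rV[R]_m) x j :
  {for x, continuous G} -> {for x, continuous (fun y => G y 0 j)}.
Proof.
move=> cG.
exact: (@continuous_comp _ _ _ G (fun v => v 0 j) x cG (@coord_continuous _ _ _ 0 j _)).
Qed.

Lemma Ck_on_continuous k n (E : normedModType R) U (F : 'rV[R]_n -> E) :
  Ck_on k U F -> forall x, U x -> {for x, continuous F}.
Proof. by case: k => [|k] []. Qed.

Lemma Ck_on1 k n (E : normedModType R) U (F : 'rV[R]_n -> E) :
  Ck_on k.+1 U F -> Ck_on 1 U F.
Proof. by elim: k => // k IH /Ck_onW. Qed.

(** By the chain rule the partials of the composite are sums of products of partials of [G] with
    partials of [f] composed with [G]; the latter are C^k by induction, which is why [f] is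
    generalized. *)
Lemma Ck_on_comp k n m U (V : set 'rV[R]_m) (f : 'rV[R]_m -> R)
    (G : 'rV[R]_n -> 'rV[R]_m) :
  open U -> open V -> (forall x, U x -> V (G x)) -> Ck_on k V f ->
  (forall j, Ck_on k U (fun x => G x 0 j)) -> Ck_on k U (fun x => f (G x)).
Proof.
move=> oU oV UV; elim: k f => [|k IH] f Cf CG.
  split => // x Ux; apply: continuous_comp.
    by apply: continuous_rV => j; exact: (Ck_on_continuous (CG j)).
  exact: (Ck_on_continuous Cf (UV _ Ux)).
have CG' j := Ck_onW (CG j).
have dfx x : U x -> differentiable f (G x).
  by move=> Ux; exact: Ck_on_differentiable oV (Ck_on1 Cf) (UV _ Ux).
have dGx x j : U x -> differentiable (fun y => G y 0 j) x.
  by move=> Ux; exact: Ck_on_differentiable oU (Ck_on1 (CG j)) Ux.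
split; first exact: Ck_on_continuous (IH _ (Ck_onW Cf) CG').
move=> i; split.
  move=> x Ux; apply: diff_derivable; apply: differentiable_comp; last exact: dfx.
  by apply: differentiable_rV => j; exact: dGx.
have CD : Ck_on k U (fun x => \sum_j 'D_('e_i) (fun y => G y 0 j) x * 'D_('e_j) f (G x)).
  apply: (Ck_on_sum _ _ oU) => j; apply: (Ck_onM oU); first exact: ((CG j).2 i).2.
  exact: (IH ('D_('e_j) f) (Cf.2 j).2 CG').
apply: (Ck_on_eq oU _ CD) => x Ux.
rewrite derive_comp; [by []|exact: dfx|by move=> j; exact: dGx].
Qed.

Lemma Ck_on_rV k n m U (G : 'rV[R]_n -> 'rV[R]_m) : open U ->
  Ck_on k U G <-> (forall j, Ck_on k U (fun x => G x 0 j)).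
Proof.
move=> oU; split.
  elim: k G => [G [cG _] j|k IH G [cG dG] j]; split => //.
  - move=> x Ux; exact: (continuous_coord (cG _ Ux)).
  - move=> x Ux; exact: (continuous_coord (cG _ Ux)).
  move=> i; have [dGi CGi] := dG i; split.
    by move=> x Ux; exact: (derivable_mxP _ _ _).1 (dGi _ Ux) 0 j.
  apply: (Ck_on_eq oU _ (IH _ CGi j)) => x Ux.
  by rewrite (derive_mx (dGi _ Ux)) mxE.
elim: k G => [G H|k IH G H]; split => //.
- by move=> x Ux; apply: continuous_rV => j; exact: (H j).1.
- by move=> x Ux; apply: continuous_rV => j; exact: (H j).1.
move=> i.
have dGi x : U x -> derivable G x 'e_i.
  by move=> Ux; apply/derivable_mxP => a j; rewrite ord1; exact: ((H j).2 i).1.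
split => //; apply: IH => j.
apply: (Ck_on_eq oU _ ((H j).2 i).2) => x Ux.
by rewrite (derive_mx (dGi _ Ux)) mxE.
Qed.

End SmoothCalculus.

(** * Ordinary differential equations *)

Section RealODE.
Context {R : realType}.
Implicit Types (t T L : R).

Lemma is_derive_expR_scale (a x : R) :
  is_derive x 1 (fun y : R => expR (a * y)) (a * expR (a * x)).
Proof.
have dl : is_derive x 1 (fun y : R => a * y) a.
  have := is_deriveZ a (is_derive_id x (1 : R)).
  by rewrite [a *: 1]mulr1.
by rewrite mulrC; exact: (is_derive1_comp (is_derive_expR (a * x)) dl).
Qed.

(* Unlike [Num.sg], [dirsg 0 = 1]. *)
Definition dirsg t : R := if 0 <= t then 1 else -1.

Lemma dirsgE t : t = dirsg t * `|t|.
Proof.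
rewrite /dirsg; case: leP => [t0|t0]; first by rewrite mul1r ger0_norm.
by rewrite mulN1r ltr0_norm// opprK.
Qed.

Lemma normr_dirsg t : `|dirsg t| = 1.
Proof. by rewrite /dirsg; case: ifP => _; rewrite ?normrN normr1. Qed.

Lemma dirsgK t : dirsg t * dirsg t = 1.
Proof. by rewrite /dirsg; case: ifP => _; rewrite ?mulrNN mulr1. Qed.

Lemma dirsg_norm t : dirsg t * t = `|t|.
Proof. by rewrite {2}[t]dirsgE mulrA dirsgK mul1r. Qed.

(** Away from 0, in either direction, [(v t + k) * expR (- C * |t|)] does not increase: [1 <= C]
    weakens the bound [C * v + k] to [C * (v + k)], so the shifted function satisfies a homogeneous
    inequality. *)
Lemma scalar_gronwall (v v' : R -> R) (C k T : R) :
  1 <= C -> 0 <= k -> (forall t, 0 <= v t) ->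
  (forall t, `|t| <= T -> is_derive t 1 v (v' t)) ->
  (forall t, `|t| <= T -> `|v' t| <= C * v t + k) ->
  forall t, `|t| <= T -> v t <= (v 0 + k) * expR (C * T).
Proof.
move=> C1 k0 v0 dv vb t tT; pose s := dirsg t; pose a := - (C * s).
have dg (x : R) : `|x| <= `|t| ->
    is_derive x 1 ((v + cst k) * (fun x : R => expR (a * x)))
      ((v' x + a * (v x + k)) * expR (a * x)).
  move=> xt; have dvx := dv _ (le_trans xt tT).
  apply: is_derive_eq (is_deriveM (is_deriveD dvx (is_derive_cst k x 1))
    (is_derive_expR_scale a x)) _.
  rewrite -![(_ + _ : _ -> _) _]/(_ + _) /cst /=.
  rewrite -![_ *: _]/(_ * _); ring.
have [x [xt tx]] := MVT_sym dg.
rewrite -![(_ * _ : _ -> _) _]/(_ * _) -![(_ + _ : _ -> _) _]/(_ + _) /cst /=.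
rewrite mulr0 expR0 mulr1 => E.
have Es : expR (a * t) = expR (- (C * `|t|)).
  by rewrite /a mulNr -mulrA dirsg_norm.
have Q : (v' x + a * (v x + k)) * expR (a * x) * t <= 0.
  rewrite mulrAC; apply: mulr_le0_ge0; last exact: expR_ge0.
  rewrite {1}[t]dirsgE mulrA -/s; apply: mulr_le0_ge0 => //.
  rewrite mulrDl /a mulNr mulNr -!mulrA [(v x + k) * s]mulrC mulrA mulrA.
  rewrite -[C * s * s]mulrA dirsgK mulr1 subr_le0.
  apply: le_trans (ler_norm _) _; rewrite normrM normr_dirsg mulr1.
  apply: le_trans (vb _ (le_trans xt tT)) _.
  by rewrite mulrDr lerD2l ler_peMl.
have {}E : (v t + k) * expR (- (C * `|t|)) <= v 0 + k.
  by rewrite -Es -subr_le0 E.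
rewrite expRN ler_pdivrMr ?expR_gt0// in E.
apply: (@le_trans _ _ (v t + k)); first by rewrite lerDl.
apply: le_trans E _; apply: ler_wpM2l; first by rewrite addr_ge0.
by rewrite ler_expR ler_wpM2l// (le_trans _ C1).
Qed.

Lemma is_derive_coord_rV (V : normedModType R) m (u : V -> 'rV[R]_m) du x v j :
  is_derive x v u du -> is_derive x v (fun s => u s 0 j) (du 0 j).
Proof.
case=> d <-; apply: DeriveDef; first exact: (derivable_mxP _ _ _).1 d 0 j.
by rewrite (derive_mx d) mxE.
Qed.

Lemma is_derive_rV (V : normedModType R) m (u : V -> 'rV[R]_m) (du : 'rV[R]_m)
    (x v : V) :
  (forall j, is_derive x v (fun s => u s 0 j) (du 0 j)) -> is_derive x v u du.
Proof.
move=> H; have d : derivable u x v.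
  by apply/derivable_mxP => i j; rewrite ord1; case: (H j).
apply: DeriveDef => //; rewrite (derive_mx d); apply/rowP => j; rewrite mxE.
by case: (H j).
Qed.

(* The bound is obtained from the scalar case applied to [\sum_j u_j^2], which
   is comparable to the square of the sup norm. *)
Lemma gronwall m (L T : R) : 0 <= L -> exists2 K : R, 0 < K &
  forall (u u' : R -> 'rV[R]_m) (eta : R), 0 <= eta ->
  (forall t, `|t| <= T -> is_derive t 1 u (u' t)) ->
  (forall t, `|t| <= T -> `|u' t| <= L * `|u t| + eta) ->
  forall t, `|t| <= T -> `|u t| <= K * (`|u 0| + eta).
Proof.
(* Each squared coordinate has derivative at most [2 |u| (L |u| + eta) <= (2 L + 1) |u|^2 + eta^2],
   and there are [m] of them; the leading 1 provides the [1 <= C] of the scalar case. *)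
move=> L0; pose C := 1 + m%:R * (2 * L + 1).
have mR0 : 0 <= m%:R :> R by [].
have C1 : 1 <= C by rewrite lerDl mulr_ge0// addr_ge0// mulr_ge0.
pose B := m%:R * expR (C * T); have B0 : 0 <= B by rewrite mulr_ge0// expR_ge0.
(* The scalar case bounds [|u t|^2] by [B * (|u 0|^2 + eta^2)]; a square root is avoided through
   [B <= (1 + B)^2]. *)
exists (1 + B); first by rewrite ltr_wpDr.
move=> u u' eta eta0 du ub t tT.
have sumc (a : R) : m%:R * a = \sum_(j < m) a.
  by rewrite sumr_const card_ord mulr_natl.
pose v s := \sum_j u s 0 j ^+ 2.
have v0 s : 0 <= v s by apply: sumr_ge0 => j _; exact: sqr_ge0.
have uv s : `|u s| ^+ 2 <= v s.
  rewrite -[leRHS]sqr_sqrtr// ler_sqr ?nnegrE ?sqrtr_ge0//.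
  apply: norm_rV_le; first exact: sqrtr_ge0.
  move=> j; rewrite -sqrtr_sqr ler_wsqrtr// /v (bigD1 j)//= lerDl.
  by apply: sumr_ge0 => *; exact: sqr_ge0.
have vu s : v s <= m%:R * `|u s| ^+ 2.
  rewrite sumc; apply: ler_sum => j _.
  by rewrite -(ger0_norm (sqr_ge0 (u s 0 j))) normrX lerXn2r ?nnegrE// le_coord_norm.
pose v' s := \sum_j (u s 0 j * u' s 0 j + u s 0 j * u' s 0 j).
have dv (s : R) : `|s| <= T -> is_derive s 1 v (v' s).
  move=> sT.
  have -> : v = \sum_j (fun s => u s 0 j * u s 0 j).
    by apply/funext => x; rewrite fct_sumE.
  apply: is_derive_sum => j.
  have duj := is_derive_coord_rV j (du _ sT).
  exact: is_derive_eq (is_deriveM duj duj) _.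
have vb (s : R) : `|s| <= T -> `|v' s| <= C * v s + m%:R * eta ^+ 2.
  move=> sT; have ubs := ub _ sT.
  have : `|v' s| <= m%:R * (2 * (`|u s| * (L * `|u s| + eta))).
    rewrite sumc.
    apply: le_trans (ler_norm_sum _ _ _) _; apply: ler_sum => j _.
    rewrite -mulr2n normrMn mulr_natl lerMn2r/= normrM.
    apply: ler_pM => //; first exact: le_coord_norm.
    by apply: le_trans ubs; exact: le_coord_norm.
  move/le_trans; apply.
  have H : 2 * (`|u s| * (L * `|u s| + eta)) <= (2 * L + 1) * `|u s| ^+ 2 + eta ^+ 2.
    by have := sqr_ge0 (`|u s| - eta); nra.
  apply: le_trans (ler_wpM2l mR0 H) _.
  rewrite [leLHS]mulrDr lerD2r mulrA /C [leRHS]mulrDl mul1r.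
  have h0 : 0 <= m%:R * (2 * L + 1) by rewrite mulr_ge0// addr_ge0// mulr_ge0.
  by apply: le_trans (ler_wpM2l h0 (uv s)) _; rewrite lerDr.
have k0 : 0 <= m%:R * eta ^+ 2 by rewrite mulr_ge0// sqr_ge0.
have G := scalar_gronwall C1 k0 v0 dv vb tT.
have n0 := normr_ge0 (u 0).
rewrite -ler_sqr ?nnegrE//; last by rewrite mulr_ge0// addr_ge0.
apply: le_trans (uv t) _; apply: le_trans G _.
apply: (@le_trans _ _ (B * (`|u 0| ^+ 2 + eta ^+ 2))).
  rewrite /B mulrAC ler_wpM2r ?expR_ge0// mulrDr lerD2r; exact: vu.
rewrite exprMn; apply: ler_pM => //; first by rewrite addr_ge0// sqr_ge0.
  by nra.
by nra.
Qed.

End RealODE.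

(** * Picard iteration *)

Section Picard.
Context {R : realType}.
Implicit Types (t T L : R).

Lemma dirsg_same s t : 0 <= s * t -> t != 0 -> dirsg t * s = `|s|.
Proof.
rewrite /dirsg; case: (leP 0 t) => [t0 st tn|t0 st _].
  have {}t0 : 0 < t by rewrite lt_def tn.
  by rewrite mul1r ger0_norm//; rewrite pmulr_lge0 in st.
by rewrite mulN1r ler0_norm//; rewrite nmulr_lge0 in st.
Qed.
Notation mu := (@lebesgue_measure R).

(** There is no mean value equality for vectors, so the scalar one is applied to [e * u_j - g] for
    each coordinate and each sign [e]. The factors [|t|] and [t] in the hypothesis cover both
    directions of time at once. *)
Lemma MVT_le m (u u' : R -> 'rV[R]_m) (g g' : R -> R) t :
  (forall s : R, `|s| <= `|t| -> is_derive s 1 u (u' s)) ->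
  (forall s : R, `|s| <= `|t| -> is_derive s 1 g (g' s)) ->
  (forall s : R, `|s| <= `|t| -> 0 <= s * t -> `|u' s| * `|t| <= g' s * t) ->
  `|u t - u 0| <= g t - g 0.
Proof.
move=> du dg H.
have H1 (e : R) j : `|e| = 1 -> e * (u t - u 0) 0 j <= g t - g 0.
  move=> e1.
  have dh (s : R) : `|s| <= `|t| ->
      is_derive s 1 (e \*: (fun s => u s 0 j) - g) (e * u' s 0 j - g' s).
    move=> st.
    exact: is_deriveB (is_deriveZ e (is_derive_coord_rV j (du _ st))) (dg _ st).
  have [s [st s0] E] := MVT_sym dh.
  rewrite -subr_ge0.
  have -> : g t - g 0 - e * (u t - u 0) 0 j = - ((e * u' s 0 j - g' s) * t).
    rewrite -E -![(_ - _ : _ -> _) _]/(_ - _) !mxE -![(_ \*: _) _]/(_ * _).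
    ring.
  rewrite -mulNr opprB mulrBl subr_ge0; apply: le_trans (H _ st s0).
  apply: le_trans (ler_norm _) _; rewrite !normrM e1 mul1r.
  by apply: ler_wpM2r => //; exact: le_coord_norm.
have g0 : 0 <= g t - g 0.
  have [s [st s0] ->] := MVT_sym dg.
  by apply: le_trans (H _ st s0); rewrite mulr_ge0.
apply: norm_rV_le => // j; rewrite ler_norml; apply/andP; split.
  by rewrite lerNl -mulN1r H1// normrN normr1.
by rewrite -[leLHS]mul1r H1// normr1.
Qed.

Lemma antiderivative (f : R -> R) T : continuous f ->
  exists2 P : R -> R, P 0 = 0 & forall t, `|t| <= T -> is_derive t 1 P (f t).
Proof.
move=> cf; have [F dF] : exists F : R -> R,
    forall t, `|t| <= T -> is_derive t 1 F (f t).
  (* Starting at [- T - 1] makes every [t] with [|t| <= T] an interior point, where the fundamental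
     theorem applies. *)
  pose F (x : R) := (\int[mu]_(y in `[(- T - 1)%R, x]) f y)%R.
  exists F => t.
  rewrite ler_norml => /andP[t1 t2].
  have tu : t < T + 2 by lra.
  have [|||dF E] := @continuous_FTC1_closed _ f (- T - 1) t (T + 2) tu.
  - apply: continuous_compact_integrable; first exact: segment_compact.
    exact: continuous_subspaceT.
  - by lra.
  - exact: cf.
  by apply: DeriveDef; [exact: dF|rewrite -derive1E; exact: E].
exists (F - cst (F 0)); first by rewrite -[LHS]/(F 0 - F 0) subrr.
move=> t /dF d.
by apply: is_derive_eq (is_deriveB d (is_derive_cst (F 0) t 1)) _; rewrite subr0.
Qed.

Lemma antiderivative_rV m (f : R -> 'rV[R]_m) T : continuous f ->
  exists2 P : R -> 'rV[R]_m, P 0 = 0 &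
    forall t, `|t| <= T -> is_derive t 1 P (f t).
Proof.
move=> cf.
have /choice[P HP] j : exists P : R -> R,
    P 0 = 0 /\ forall t, `|t| <= T -> is_derive t 1 P (f t 0 j).
  have cfj : continuous (fun t => f t 0 j).
    by move=> t; apply: continuous_coord; exact: cf.
  by have [P P0 dP] := antiderivative T cfj; exists P.
exists (fun t => \row_j P j t); first by apply/rowP => j; rewrite !mxE (HP j).1.
move=> t tT; apply: is_derive_rV => j.
have -> : (fun s => (\row_j P j s) 0 j) = P j by apply/funext => s; rewrite mxE.
exact: (HP j).2.
Qed.

(** With [a k] the bound on the tail, every left end [u k - a k] lies below every right end
    [u q + a q], so the supremum of the left ends belongs to all these intervals. This yields the
    limit together with its rate. *)
Lemma geometric_cvg (u : nat -> R) (C : R) :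
  (forall k, `|u k.+1 - u k| <= C / 2 ^+ k) ->
  exists l, forall k, `|l - u k| <= C * 2 / 2 ^+ k.
Proof.
move=> H.
have D k p : `|u (k + p)%N - u k| <= C * 2 / 2 ^+ k - C * 2 / 2 ^+ (k + p).
  elim: p => [|p IH]; first by rewrite addn0 !subrr normr0.
  rewrite addnS -(subrKA (u (k + p)%N)); apply: le_trans (ler_normD _ _) _.
  apply: le_trans (lerD (H _) IH) _.
  rewrite exprS invfM; have := @mulVf R 2; lra.
have C0 : 0 <= C by have := le_trans (normr_ge0 _) (H 0%N); rewrite expr0 divr1.
pose a k : R := C * 2 / 2 ^+ k.
have a0 k : 0 <= a k by rewrite divr_ge0 ?exprn_ge0// mulr_ge0.
have ua k q : u k - a k <= u q + a q.
  have [kq|/ltnW qk] := leqP k q.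
    have := D k (q - k)%N; rewrite subnKC// -/(a k) -/(a q) => /ler_normlP[h1 h2].
    by have := a0 q; lra.
  have := D q (k - q)%N; rewrite subnKC// -/(a k) -/(a q) => /ler_normlP[h1 h2].
  by have := a0 k; lra.
pose A := range (fun k => u k - a k).
have ubA q : ubound A (u q + a q) by move=> _ [k _ <-]; exact: ua.
have A0 : A !=set0 by exists (u 0%N - a 0%N), 0%N.
have sA : has_sup A by split => //; exists (u 0%N + a 0%N); exact: ubA.
exists (sup A) => k; rewrite -/(a k) ler_norml; apply/andP; split.
  by rewrite lerBrDl; apply: ub_le_sup; [exact: sA.2|exists k].
by rewrite lerBlDl; apply: ge_sup => //; exact: ubA.
Qed.

Lemma geometric_cvg_rV m (u : nat -> 'rV[R]_m) (C : R) :
  (forall k, `|u k.+1 - u k| <= C / 2 ^+ k) ->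
  exists l, forall k, `|l - u k| <= C * 2 / 2 ^+ k.
Proof.
move=> H.
have C0 : 0 <= C by have := le_trans (normr_ge0 _) (H 0%N); rewrite expr0 divr1.
have /choice[l Hl] j : exists l, forall k, `|l - u k 0 j| <= C * 2 / 2 ^+ k.
  apply: geometric_cvg => k; apply: le_trans (H k).
  by apply: le_trans (le_coord_norm _ j); rewrite !mxE.
exists (\row_j l j) => k; apply: norm_rV_le.
  by rewrite divr_ge0 ?exprn_ge0// mulr_ge0.
by move=> j; rewrite !mxE.
Qed.

Lemma geometric_small (C e : R) : 0 < e -> exists k, C / 2 ^+ k < e.
Proof.
move=> e0.
have [k Ck] : exists k : nat, C / e < k%:R.
  exists (Num.bound `|C / e|); apply: le_lt_trans (ler_norm _) _.
  exact: archi_boundP.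
exists k; rewrite ltr_pdivrMr ?exprn_gt0// mulrC -ltr_pdivrMr//.
apply: lt_trans Ck _; rewrite -natrX ltr_nat; exact: ltn_expl.
Qed.

Lemma bounded_on_segment (V : normedModType R) (u : R -> V) T : continuous u ->
  exists2 M : R, 0 <= M & forall t, `|t| <= T -> `|u t| <= M.
Proof.
move=> cu; have [T0|T0] := leP 0 T; last first.
  exists 0 => // t tT; have := le_trans (normr_ge0 _) tT; lra.
have cn : {within `[- T, T], continuous (fun t => `|u t|)}.
  apply: continuous_subspaceT => t.
  by apply: (continuous_comp (cu t)); exact: norm_continuous.
have le_T : - T <= T by lra.
have [c _ H] := EVT_max le_T cn; exists `|u c| => // t.
by rewrite ler_norml => tT; apply: H; rewrite in_itv.
Qed.

(** Projection of the line onto [[- T, T]]: composing with it extends to all times a curve that is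
    controlled only for [|t| <= T]. *)
Definition clip T t : R := Num.max (- T) (Num.min T t).

Lemma clip_le T t : 0 <= T -> `|clip T t| <= T.
Proof.
move=> T0; rewrite ler_norml /clip le_max lexx/= ge_max ge_min lexx andbT.
by rewrite (le_trans _ T0)// oppr_le0.
Qed.

Lemma clip_id T t : `|t| <= T -> clip T t = t.
Proof.
by rewrite ler_norml /clip => /andP[h1 h2]; rewrite (min_idPr h2) (max_idPr h1).
Qed.

Lemma clip_lipschitz T s t : `|clip T s - clip T t| <= `|s - t|.
Proof.
rewrite /clip /Num.max /Num.min.
have := ler_norm (s - t); have := ler_norm (t - s); rewrite (distrC t s) ler_norml.
by case: (ltP T s) => ?; case: (ltP T t) => ?; case: (ltP (- T) T) => ?;
   case: (ltP (- T) s) => ?; case: (ltP (- T) t) => ?; lra.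
Qed.

Lemma continuous_clip T : continuous (clip T).
Proof.
move=> t; apply/cvgrPdist_le => e e0; apply/(@nbhs0_normP _ R^o t); exists e => // s st.
by apply: le_trans (clip_lipschitz T t s) _; rewrite distrC ltW.
Qed.

(** The solution exists on the whole prescribed interval, however large [L * T] is, thanks to an
    exponentially weighted norm. Continuity is only asked of [G] along continuous curves, which is
    what integrating the right-hand side takes. *)
Lemma picard m (G : R -> 'rV[R]_m -> 'rV[R]_m) L T (y : 'rV[R]_m) :
  0 <= L -> 0 <= T ->
  (forall u, continuous u -> continuous (fun t => G t (u t))) ->
  (forall t v w, `|t| <= T -> `|G t v - G t w| <= L * `|v - w|) ->
  exists2 u : R -> 'rV[R]_m, u 0 = y &
    forall t, `|t| <= T -> is_derive t 1 u (G t (u t)).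
Proof.
move=> L0 T0 cG lG.
(* Antiderivatives are chosen for all functions at once; discontinuous ones get the dummy value
   0. *)
have /choice[P HP] (f : R -> 'rV[R]_m) : exists P : R -> 'rV[R]_m,
    continuous f -> P 0 = 0 /\ forall t, `|t| <= T -> is_derive t 1 P (f t).
  have [cf|ncf] := pselect (continuous f); last by exists (fun=> 0).
  by have [P P0 dP] := antiderivative_rV T cf; exists P.
pose Q (u : R -> 'rV[R]_m) := P (fun t => G t (u t)).
have Q0 u : continuous u -> Q u 0 = 0 by move=> cu; exact: (HP _ (cG _ cu)).1.
have dQ u : continuous u -> forall t, `|t| <= T -> is_derive t 1 (Q u) (G t (u t)).
  by move=> cu; exact: (HP _ (cG _ cu)).2.
(* Clipping the time makes every iterate continuous on the whole line, so that the next
   antiderivative exists. *)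
pose step (u : R -> 'rV[R]_m) (t : R) : 'rV[R]_m := y + Q u (clip T t).
have cstep u : continuous u -> continuous (step u).
  move=> cu t; have cQ : {for t, continuous (Q u \o clip T)}.
    apply: continuous_comp; first exact: continuous_clip.
    exact: is_derive_continuous (dQ _ cu _ (clip_le _ T0)).
  suff : {for t, continuous ((fun=> y) + (Q u \o clip T))} by [].
  apply: continuousD => //; exact: continuous_cst_for.
have sub2 (p q : 'rV[R]_m) : y + p - (y + q) = p - q.
  by rewrite opprD addrACA subrr add0r.
pose g k := iter k step (fun=> y).
have cg k : continuous (g k).
  by elim: k => [|k IH]; [move=> t; exact: cvg_cst|exact: cstep].
(* From [2 * L <= a] the contraction factor is at most 1/2; the added 1 keeps [a] positive when
   [L = 0]. *)
pose a := 2 * L + 1; have a0 : 0 < a by rewrite /a; lra.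
(* Weighting by [expR (a * `|t|)] makes one Picard step contract by [L / a]. *)
have contr u v (M : R) : continuous u -> continuous v -> 0 <= M ->
    (forall t, `|t| <= T -> `|u t - v t| <= M * expR (a * `|t|)) ->
    forall t, `|t| <= T -> `|Q u t - Q v t| <= M / 2 * expR (a * `|t|).
  move=> cu cv M0 uv t tT; pose b := a * dirsg t.
  have d1 (s : R) : `|s| <= `|t| ->
      is_derive s 1 (Q u - Q v) (G s (u s) - G s (v s)).
    by move=> st; apply: is_deriveB; apply: dQ => //; exact: le_trans tT.
  have d2 (s : R) : `|s| <= `|t| ->
      is_derive s 1 ((M / 2) \*: (fun s => expR (b * s)))
        (M / 2 * (b * expR (b * s))).
    by move=> st; exact: is_deriveZ (is_derive_expR_scale b s).
  have H (s : R) : `|s| <= `|t| -> 0 <= s * t ->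
      `|G s (u s) - G s (v s)| * `|t| <= M / 2 * (b * expR (b * s)) * t.
    have [->|t0] := eqVneq t 0; first by rewrite normr0 !mulr0.
    move=> st s0; have sT := le_trans st tT.
    have -> : b * s = a * `|s| by rewrite /b -mulrA dirsg_same.
    have -> : M / 2 * (b * expR (a * `|s|)) * t = M / 2 * a * expR (a * `|s|) * `|t|.
      by rewrite -(dirsg_norm t) /b; ring.
    apply: ler_wpM2r => //; apply: le_trans (lG _ _ _ sT) _.
    apply: le_trans (ler_wpM2l L0 (uv _ sT)) _; rewrite mulrA.
    apply: ler_wpM2r; first exact: expR_ge0.
    by rewrite /a; nra.
  have := MVT_le d1 d2 H.
  rewrite -![(_ - _ : _ -> _) _]/(_ - _) -![(_ \*: _) _]/(_ * _) !Q0// subrr subr0.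
  move=> /le_trans; apply; rewrite mulr0 expR0 /b -mulrA dirsg_norm.
  by rewrite lerBlDr lerDl mulr1 divr_ge0.
have [M M0 HM] := bounded_on_segment T (fun t => continuousB (cg 1%N t) (cg 0%N t)).
have M2 k : 0 <= M / 2 ^+ k by rewrite divr_ge0 ?exprn_ge0.
have Hk k t : `|t| <= T -> `|g k.+1 t - g k t| <= M / 2 ^+ k * expR (a * `|t|).
  elim: k t => [|k IH] t tT.
    rewrite expr0 divr1; apply: le_trans (HM t tT) _; rewrite ler_peMr//.
    by rewrite -expR0 ler_expR mulr_ge0// ltW.
  rewrite [X in _ <= X * _](_ : _ = M / 2 ^+ k / 2); last first.
    by rewrite exprS invfM [2^-1 * _]mulrC mulrA.
  rewrite -[g k.+2 t]/(y + Q (g k.+1) (clip T t)) -[g k.+1 t]/(y + Q (g k) (clip T t)).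
  by rewrite sub2 clip_id// contr.
have gclip k t : g k t = g k (clip T t).
  by case: k => [//|k] /=; rewrite /step (clip_id (clip_le t T0)).
pose C := M * expR (a * T).
have HC k t : `|g k.+1 t - g k t| <= C / 2 ^+ k.
  rewrite gclip (gclip k); apply: le_trans (Hk _ _ (clip_le t T0)) _.
  rewrite /C [leRHS]mulrAC; apply: ler_wpM2l => //.
  by rewrite ler_expR ler_wpM2l ?clip_le// ltW.
have /choice[u Hu] t : exists l, forall k, `|l - g k t| <= C * 2 / 2 ^+ k.
  by apply: geometric_cvg_rV => k; exact: HC.
have C0 : 0 <= C by rewrite mulr_ge0// expR_ge0.
have cu : continuous u.
  move=> t; apply/cvgrPdist_lt => e e0.
  have e3 : 0 < e / 3 by rewrite divr_gt0.
  have [k Ck] := geometric_small (C * 2) e3.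
  near=> s; have st : `|g k t - g k s| < e / 3.
    by near: s; exact: (cvgrPdist_lt _ _).1 (cg k t) _ e3.
  have := Hu t k; have := Hu s k; rewrite [X in X <= _ -> _]distrC => h1 h2.
  rewrite -(subrKA (g k t)) -[X in _ + X](subrKA (g k s)).
  apply: le_lt_trans (ler_normD _ _) _.
  have := ler_normD (g k t - g k s) (g k s - u s); lra.
(* The limit is a fixed point: both [u] and [y + Q u] are within a multiple of [2 ^- k] of the
   iterate [g k.+1]. *)
have uE t : `|t| <= T -> y + Q u t = u t.
  move=> tT; apply/eqP; rewrite -subr_eq0 -normr_le0; apply/ler_addgt0Pl => e e0.
  rewrite addr0.
  have [k Ck] := geometric_small (C * 2 + C * 2 * expR (a * T)) e0.
  apply: ltW; apply: le_lt_trans Ck.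
  have ge1 (s : R) : 1 <= expR (a * `|s|).
    by rewrite -expR0 ler_expR mulr_ge0// ltW.
  have B0 : 0 <= C * 2 / 2 ^+ k by rewrite divr_ge0 ?exprn_ge0// mulr_ge0.
  have H s : `|s| <= T -> `|u s - g k s| <= C * 2 / 2 ^+ k * expR (a * `|s|).
    by move=> _; apply: le_trans (Hu s k) _; rewrite ler_peMr.
  have := contr _ _ _ cu (cg k) B0 H t tT.
  have -> : Q u t - Q (g k) t = y + Q u t - g k.+1 t.
    by rewrite -[g k.+1 t]/(y + Q (g k) (clip T t)) clip_id// sub2.
  have := Hu t k.+1; rewrite distrC => h1 h2.
  rewrite -(subrKA (g k.+1 t)); apply: le_trans (ler_normD _ _) _.
  have h3 : expR (a * `|t|) <= expR (a * T) by rewrite ler_expR ler_wpM2l// ltW.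
  have p0 : 0 <= (2 ^+ k)^-1 :> R by rewrite invr_ge0 exprn_ge0.
  have h4 : C * 2 / 2 ^+ k / 2 * expR (a * `|t|) <= C * 2 / 2 ^+ k * expR (a * T).
    have h6 : C * 2 / 2 ^+ k / 2 <= C * 2 / 2 ^+ k.
      by rewrite ler_pdivrMr// ler_peMr// ler1n.
    by apply: ler_pM => //; rewrite ?expR_ge0// divr_ge0.
  have h5 : C * 2 / 2 ^+ k.+1 <= C * 2 / 2 ^+ k.
    rewrite ler_wpM2l ?mulr_ge0// lef_pV2 ?posrE ?exprn_gt0//.
    by rewrite exprS ler_peMl ?exprn_ge0// ler1n.
  rewrite mulrDl mulrAC; lra.
exists (fun t => y + Q u t); first by rewrite Q0// addr0.
move=> t tT; rewrite uE//.
by apply: is_derive_eq (is_deriveD (is_derive_cst y t 1) (dQ _ cu _ tT)) (add0r _).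
Unshelve. all: by end_near. Qed.

End Picard.

(** * Smooth dependence on initial conditions *)

Section UniformOnCompact.
Context {R : realType}.

(** A Lebesgue number argument: half of the radius at [a] is spent on the distance from [a] to [x],
    the other half on that from [x] to [y]. *)
Lemma compact_uniform (V : normedModType R) (K : set V) (P : V -> V -> Prop) :
  compact K ->
  (forall a, K a -> exists2 d : R, 0 < d &
     forall x y, `|x - a| < d -> `|y - a| < d -> P x y) ->
  exists2 d : R, 0 < d & forall x y, K x -> `|y - x| < d -> P x y.
Proof.
move=> /compact_near_coveringP cK H.
pose Q (d : R) (x : V) := forall y, `|y - x| < d -> P x y.
have : \forall d \near 0^'+, K `<=` Q d.
  apply: (cK R (0^'+) Q) => a /H[d d0 Hd].
  exists ([set x | `|x - a| < d / 2], [set e : R | e < d / 2]) => /=.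
    split; last by apply: nbhs_right_lt; rewrite divr_gt0.
    by apply/nbhs0_normP; exists (d / 2) => //; rewrite divr_gt0.
  move=> [x e] /= [xa ed] y yx; apply: Hd; first by lra.
  rewrite -(subrKA x); apply: le_lt_trans (ler_normD _ _) _; lra.
move=> near0; near (0 : R)^'+ => d; exists d => //.
have Kd : K `<=` Q d by near: d.
by move=> x y Kx; exact: Kd.
Unshelve. all: by end_near. Qed.

Lemma continuous_mx (T : topologicalType) m n (G : T -> 'M[R]_(m, n)) x :
  (forall i j, {for x, continuous (fun y => G y i j)}) -> {for x, continuous G}.
Proof.
move=> cG; apply/cvgrPdist_lt => e e0.
have : \forall y \near x, forall ij : 'I_m * 'I_n, `|G x ij.1 ij.2 - G y ij.1 ij.2| < e.
  by apply: near_forall => -[i j]; exact: (cvgrPdist_lt _ _).1 (cG i j) _ e0.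
apply: filterS => y H; rewrite [ltLHS]/Num.Def.normr/= mx_normrE.
by apply/bigmax_ltP; split => // ij _; rewrite !mxE; exact: H.
Qed.

Lemma norm_mulmx_le m n (v : 'rV[R]_m) (A : 'M[R]_(m, n)) :
  `|v *m A| <= m%:R * `|A| * `|v|.
Proof.
apply: norm_rV_le; first by rewrite !mulr_ge0.
move=> j; rewrite mxE; apply: le_trans (ler_norm_sum _ _ _) _.
apply: (@le_trans _ _ (\sum_(k < m) `|A| * `|v|)).
  apply: ler_sum => k _; rewrite normrM mulrC.
  by apply: ler_pM => //; [exact: le_entry_norm|exact: le_coord_norm].
by rewrite sumr_const card_ord -[leLHS]mulr_natl mulrA.
Qed.

(** Vectors are rows, so this is the transpose of the usual Jacobian matrix: the derivative of [F]
    at [w] along [v] is [v *m jac F w]. *)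
Definition jac m (F : 'rV[R]_m -> 'rV[R]_m) (w : 'rV[R]_m) : 'M[R]_m :=
  \matrix_(k, j) 'D_('e_k) (fun w => F w 0 j) w.

Lemma jac_continuous m (F : 'rV[R]_m -> 'rV[R]_m) W w :
  (forall j, Ck_on 1 W (fun w => F w 0 j)) -> W w -> {for w, continuous (jac F)}.
Proof.
move=> CF Ww; apply: continuous_mx => k j.
have -> : (fun y => jac F y k j) = 'D_('e_k) (fun w => F w 0 j).
  by apply/funext => y; rewrite mxE.
by have [_ /(_ k)[_ [cD _]]] := CF j; exact: cD.
Qed.

(** The expansion is uniform in a moving base point [x], as needed to compare two nearby solutions
    at all times. It follows from the mean value theorem on the segment and the continuity of the
    Jacobian matrix at [a]. *)
Lemma strict_differentiability m (F : 'rV[R]_m -> 'rV[R]_m) W a (e : R) :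
  open W -> (forall j, Ck_on 1 W (fun w => F w 0 j)) -> W a -> 0 < e ->
  exists2 d : R, 0 < d & forall x y, `|x - a| < d -> `|y - a| < d ->
    W y /\ `|F y - F x - (y - x) *m jac F x| <= e * `|y - x|.
Proof.
move=> oW CF Wa e0.
(* Factor 2: the Jacobian matrices at [x] and at the intermediate point are both compared with the
   one at [a]. Factor [m.+1]: the errors of [m] coordinates add up, and [m] may be 0. *)
have e1 : 0 < e / (2 * m.+1%:R) by rewrite divr_gt0// mulr_gt0.
have : \forall w \near a, W w /\ `|jac F a - jac F w| < e / (2 * m.+1%:R).
  near=> w; split; first by near: w; exact: open_nbhs_nbhs.
  near: w; apply: (cvgrPdist_lt _ _).1 e1; exact: jac_continuous CF Wa.
move=> /nbhs0_normP[d d0 Hd]; exists d => // x y xa ya; split.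
  by have [] := Hd _ ya.
apply: norm_rV_le; first by rewrite mulr_ge0// ltW.
move=> j.
(* [y - x] is reached along a segment inside the (convex) ball. *)
have seg (t : R) : 0 <= t <= 1 -> `|t *: (y - x) + x - a| < d.
  move=> /andP[t0 t1].
  have -> : t *: (y - x) + x - a = t *: (y - a) + (1 - t) *: (x - a).
    by apply/rowP => k; rewrite !mxE; ring.
  apply: le_lt_trans (ler_normD _ _) _; rewrite !normrZ ger0_norm// ger0_norm; last by lra.
  have [->|tn0] := eqVneq t 0; first by rewrite mul0r add0r subr0 mul1r.
  have tp : 0 < t by rewrite lt_def tn0.
  have h1 : t * `|y - a| < t * d by rewrite ltr_pM2l.
  have h2 : (1 - t) * `|x - a| <= (1 - t) * d by apply: ler_wpM2l (ltW xa); lra.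
  by apply: lt_le_trans (ltr_leD h1 h2) _; rewrite -mulrDl addrC subrK mul1r.
pose f w : R := F w 0 j.
have df (t : R) : 0 <= t <= 1 -> derivable f (t *: (y - x) + x) (y - x).
  move=> /seg/Hd[Wt _]; apply: diff_derivable; exact: Ck_on_differentiable oW (CF j) Wt.
have [||t] := @MVT_segment _ (fun s : R => f (s *: (y - x) + x))
   (fun t => 'D_(y - x) f (t *: (y - x) + x)) 0 1 ler01.
- move=> t; rewrite in_itv/= => /andP[t0 t1]; apply: is_derive_line; apply: df.
  by rewrite !ltW.
- apply: continuous_in_subspaceT => t; rewrite inE/= in_itv/= => t01.
  exact: is_derive_continuous (is_derive_line (df _ t01)).
rewrite in_itv/= => t01; rewrite scale0r add0r scale1r subrK subr0 mulr1.
rewrite (Ck_on_derive _ oW (CF j) (Hd _ (seg _ t01)).1) => E.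
rewrite !mxE -/(f y) -/(f x) E -sumrB.
apply: le_trans (ler_norm_sum _ _ _) _.
apply: (@le_trans _ _ (\sum_(k < m) e / m.+1%:R * `|y - x|)).
  apply: ler_sum => k _; rewrite [X in `|X - _|](_ : _ =
      (y - x) 0 k * jac F (t *: (y - x) + x) k j); last first.
    by rewrite [jac _ _ _ _]mxE.
  rewrite -mulrBr normrM mulrC; apply: ler_pM => //; last exact: le_coord_norm.
  rewrite -(subrKA (jac F a k j)); apply: le_trans (ler_normD _ _) _.
  have := (Hd _ (seg _ t01)).2; have := (Hd _ xa).2.
  move=> /ltW/(le_trans (le_entry_norm _ k j)); rewrite !mxE => h1.
  move=> /ltW/(le_trans (le_entry_norm _ k j)); rewrite !mxE distrC => h2.
  apply: le_trans (lerD h2 h1) _.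
  by rewrite invfM mulrA -mulrDl -splitr.
rewrite -mulr_suml ler_wpM2r// sumr_const card_ord -[leLHS]mulr_natl mulrA.
by rewrite ler_pdivrMr// mulrC; apply: ler_wpM2l; [exact: ltW|rewrite ler_nat].
Unshelve. all: by end_near. Qed.

End UniformOnCompact.

(** * Moving one coordinate, the time *)

Section SetTime.
Context {R : realType} {n : nat} (i0 : 'I_n).
Implicit Types (x y : 'rV[R]_n) (s t : R).

Definition set_time x t : 'rV[R]_n := \row_j (if j == i0 then t else x 0 j).

Lemma set_timeE x t : set_time x t = t *: 'e_i0 + set_time x 0.
Proof.
apply/rowP => j; rewrite !mxE eqxx/=.
by case: ifP => _; rewrite ?mulr1 ?addr0 ?mulr0 ?add0r.
Qed.

Lemma set_time_coord x t : set_time x t 0 i0 = t.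
Proof. by rewrite mxE eqxx. Qed.

Lemma set_time_id x : set_time x (x 0 i0) = x.
Proof. by apply/rowP => j; rewrite mxE; case: eqP => [->|]. Qed.

Lemma set_time_add x h t i : i != i0 ->
  set_time (h *: 'e_i + x) t = h *: 'e_i + set_time x t.
Proof.
move=> ii0; apply/rowP => j; rewrite !mxE eqxx/=; case: (eqVneq j i0) => // ->.
by rewrite eq_sym (negbTE ii0) mulr0 add0r.
Qed.

Lemma set_time_shift x h : set_time x (h + x 0 i0) = h *: 'e_i0 + x.
Proof.
rewrite set_timeE scalerDl -addrA -[x 0 i0 *: _ + _](_ : x = _)//.
by rewrite -set_timeE set_time_id.
Qed.

Lemma set_time_dist x y t : `|set_time x t - set_time y t| <= `|x - y|.
Proof.
apply: norm_rV_le => // j; rewrite !mxE; case: ifP => _.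
  by rewrite subrr normr0.
by apply: le_trans (le_coord_norm _ j); rewrite !mxE.
Qed.

Lemma continuous_set_time x : continuous (set_time x).
Proof.
move=> t; apply: continuous_rV => j.
rewrite (_ : (fun s : R => _) = if j == i0 then id else fun=> x 0 j); last first.
  by apply/funext => s; rewrite mxE; case: ifP.
by case: ifP => _; [exact: cvg_id|exact: continuous_cst_for].
Qed.

Lemma is_derive_set_time (V : normedModType R) (f : 'rV[R]_n -> V) x t df :
  is_derive (set_time x t) 'e_i0 f df ->
  is_derive t 1 (fun s => f (set_time x s)) df.
Proof.
rewrite set_timeE => -[d <-].
have -> : (fun s => f (set_time x s)) = fun s => f (s *: 'e_i0 + set_time x 0).
  by apply/funext => s; rewrite set_timeE.
exact: is_derive_line.
Qed.

Lemma is_derive_of_set_time (V : normedModType R) (f : 'rV[R]_n -> V) x df :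
  is_derive (x 0 i0) 1 (fun s => f (set_time x s)) df -> is_derive x 'e_i0 f df.
Proof.
have E :
    (fun h : R => h^-1 *: (((fun s => f (set_time x s)) \o shift (x 0 i0)) (h *: (1 : R))
       - f (set_time x (x 0 i0))))
   = (fun h : R => h^-1 *: ((f \o shift x) (h *: 'e_i0) - f x)).
  apply/funext => h /=; congr (_ *: (f _ - f _)); last exact: set_time_id.
  by rewrite [h *: 1]mulr1 set_time_shift.
by case; rewrite /derivable /derive E => d <-; apply: DeriveDef.
Qed.

End SetTime.

Section DerivativeBounds.
Context {R : realType}.

Lemma is_derive_of_bound (V W : normedModType R) (f : V -> W) x v df :
  (forall e : R, 0 < e -> exists2 d : R, 0 < d & forall h : R, `|h| < d ->
     `|f (h *: v + x) - f x - h *: df| <= e * `|h|) ->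
  is_derive x v f df.
Proof.
move=> H.
have C : (fun h : R => h^-1 *: ((f \o shift x) (h *: v) - f x)) @ 0^' --> df.
  apply/cvgrPdist_le => e e0; have [d d0 Hd] := H e e0.
  near=> h; have h0 : h != 0 by near: h; exact: nbhs_dnbhs_neq.
  have hd : `|h| < d by near: h; exact: dnbhs0_lt.
  have := Hd _ hd; rewrite -ler_pdivrMr ?normr_gt0//; apply: le_trans.
  rewrite distrC mulrC -normfV -normrZ [in leRHS]scalerBr scalerA mulVf//.
  by rewrite scale1r.
by apply: DeriveDef; [apply/cvg_ex; exists df|exact: cvg_lim C].
Unshelve. all: by end_near. Qed.

Lemma is_derive_bound (V W : normedModType R) (f : V -> W) x v df (e : R) :
  is_derive x v f df -> 0 < e -> exists2 d : R, 0 < d & forall h : R, `|h| < d ->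
     `|f (h *: v + x) - f x - h *: df| <= e * `|h|.
Proof.
move=> [dfx E] e0.
have : (fun h : R => h^-1 *: ((f \o shift x) (h *: v) - f x)) @ 0^' --> df.
  by rewrite -E; exact: dfx.
move=> /cvgrPdist_le/(_ e e0)[d /= d0 Hd]; exists d => // h hd.
have [->|h0] := eqVneq h 0.
  by rewrite !scale0r add0r subr0 subrr !normr0 mulr0.
have := Hd h _ h0; rewrite /= sub0r normrN => /(_ hd).
rewrite distrC -(ler_pM2r (_ : 0 < `|h|)) ?normr_gt0//; apply: le_trans.
by rewrite [leRHS]mulrC -normrZ [in leRHS]scalerBr scalerA mulfV// scale1r.
Qed.

End DerivativeBounds.

Lemma continuous_for_le (R : realType) (T : topologicalType)
    (V : normedModType R) (f : T -> V) x :
  (forall e : R, 0 < e -> \forall y \near x, `|f x - f y| <= e) ->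
  {for x, continuous f}.
Proof. by move=> H; apply/cvgrPdist_le. Qed.

Lemma near_dist_lt (R : realType) (V : normedModType R) (x : V) (d : R) :
  0 < d -> \forall y \near x, `|y - x| < d.
Proof. by move=> d0; apply/nbhs0_normP; exists d. Qed.

(* The coordinate [i0] is the time of the equation [d_i0 phi = F(phi)], with
   initial value [phi0] on the slice [x_i0 = 0]. *)
Section ParameterDerivative.
Context {R : realType} {n m : nat}.
Variables (i0 : 'I_n) (rho : R) (O : set 'rV[R]_n) (W : set 'rV[R]_m)
  (F : 'rV[R]_m -> 'rV[R]_m) (phi phi0 : 'rV[R]_n -> 'rV[R]_m).
Hypotheses (oO : open O)
  (O_lt : forall x, O x -> `|x 0 i0| < rho)
  (O_time : forall x t, O x -> `|t| < rho -> O (set_time i0 x t))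
  (oW : open W) (phiW : forall x, O x -> W (phi x))
  (CF : forall j, Ck_on 1 W (fun w => F w 0 j))
  (cphi : forall x, O x -> {for x, continuous phi})
  (dphi : forall x, O x -> is_derive x 'e_i0 phi (F (phi x)))
  (Cphi0 : forall j, Ck_on 1 O (fun x => phi0 x 0 j))
  (phi_init : forall x, O x -> x 0 i0 = 0 -> phi x = phi0 x).

Local Notation p := (set_time i0).

Let Kp x (T : R) := p x @` [set t | `|t| <= T].

Lemma compact_segment_norm (T : R) : compact [set t : R | `|t| <= T].
Proof.
have -> : [set t : R | `|t| <= T] = `[- T, T]%classic.
  by apply/seteqP; split => t; rewrite /= in_itv/= ler_norml.
exact: segment_compact.
Qed.

Lemma compact_path x T : compact (Kp x T).
Proof.
apply: continuous_compact; last exact: compact_segment_norm.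
by apply: continuous_subspaceT => t; exact: continuous_set_time.
Qed.

Lemma path_sub x T t : O x -> T < rho -> `|t| <= T -> O (p x t).
Proof. by move=> Ox Tr tT; apply: O_time => //; exact: le_lt_trans Tr. Qed.

(** Compactness of the time segment through [x] gives a tube of constant radius around it, contained
    in [O]. *)
Lemma uniform_on_path (V : normedModType R) (f : 'rV[R]_n -> V) x T (e : R) :
  O x -> T < rho -> 0 < e -> (forall y, O y -> {for y, continuous f}) ->
  exists2 d : R, 0 < d & forall t y, `|t| <= T -> `|y - p x t| < d ->
    O y /\ `|f y - f (p x t)| < e.
Proof.
move=> Ox Tr e0 cf.
have [|d d0 Hd] := @compact_uniform _ _ (Kp x T)
    (fun a b => O b /\ `|f b - f a| < e) (@compact_path x T); last first.
  by exists d => // t y tT; apply: Hd; exists t.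
move=> _ [t /= tT <-]; set a := p x t; have Oa : O a := path_sub Ox Tr tT.
have : \forall y \near a, O y /\ `|f a - f y| < e / 2.
  near=> y; split; first by near: y; exact: open_nbhs_nbhs.
  by near: y; apply: (cvgrPdist_lt _ _).1 (cf _ Oa) _ _; rewrite divr_gt0.
move=> /nbhs0_normP[d d0 Hd]; exists d => // y z ya za.
have [_ h1] := Hd _ ya; have [Oz h2] := Hd _ za; split => //.
rewrite -(subrKA (f a)); apply: le_lt_trans (ler_normD _ _) _.
by rewrite distrC; lra.
Unshelve. all: by end_near. Qed.

Lemma path_derive x t : O (p x t) ->
  is_derive t 1 (fun s => phi (p x s)) (F (phi (p x t))).
Proof. by move=> Op; apply: is_derive_set_time; exact: dphi. Qed.

Lemma jac_phi_continuous y : O y -> {for y, continuous (fun y => jac F (phi y))}.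
Proof.
move=> Oy; apply: continuous_comp; first exact: cphi.
by apply: (jac_continuous CF); exact: phiW.
Qed.

Lemma jac_bound x T : O x -> T < rho ->
  exists2 C : R, 0 <= C & forall t, `|t| <= T -> `|jac F (phi (p x t))| <= C.
Proof.
move=> Ox Tr; have [T0|T0] := leP 0 T; last first.
  by exists 0 => // t tT; have := le_trans (normr_ge0 _) tT; rewrite leNgt T0.
have cJ : continuous (fun t : R => jac F (phi (p x (clip T t)))).
  move=> t; apply: (@continuous_comp _ _ _ (fun t => p x (clip T t))
    (fun y => jac F (phi y))).
    apply: continuous_comp; [exact: continuous_clip|exact: continuous_set_time].
  by apply: jac_phi_continuous; apply: path_sub Tr _ => //; exact: clip_le.
have [C C0 HC] := bounded_on_segment T cJ; exists C => // t tT.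
by have := HC t tT; rewrite clip_id.
Qed.

Lemma continuous_mulmx_rV (u : R -> 'rV[R]_m) (J : R -> 'M[R]_m) :
  continuous u -> continuous J -> continuous (fun t => u t *m J t).
Proof.
move=> cu cJ t; apply: continuous_rV => j.
have -> : (fun s => (u s *m J s) 0 j) = fun s => \sum_k u s 0 k * J s k j.
  by apply/funext => s; rewrite mxE.
apply: (@cvg_sumr _ _ _ _ (nbhs t)) => k; apply: cvgM.
  exact: (continuous_coord (cu t)).
exact: (@continuous_comp _ _ _ J (fun A => A k j) t (cJ t) (@coord_continuous _ _ _ k j _)).
Qed.

(** The first variation equation is linear, hence Lipschitz with a constant read off a bound of the
    Jacobian matrix along the path. Its solution [u] is the candidate for the derivative of [phi]
    along [e_i]. *)
Lemma variation_exists x T i : O x -> 0 <= T -> T < rho ->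
  exists2 u : R -> 'rV[R]_m, u 0 = 'D_('e_i) phi0 (p x 0) &
    forall t : R, `|t| <= T -> is_derive t 1 u (u t *m jac F (phi (p x t))).
Proof.
move=> Ox T0 Tr; have [C C0 HC] := jac_bound Ox Tr.
pose J t := jac F (phi (p x (clip T t))).
have cJ : continuous J.
  move=> t; apply: (@continuous_comp _ _ _ (fun t => p x (clip T t))
    (fun y => jac F (phi y))).
    apply: continuous_comp; [exact: continuous_clip|exact: continuous_set_time].
  by apply: jac_phi_continuous; apply: path_sub Tr _ => //; exact: clip_le.
have [||t v w tT|u u0 du] := @picard _ m (fun t v => v *m J t) (m%:R * C) T
  ('D_('e_i) phi0 (p x 0)) _ T0.
- by rewrite mulr_ge0.
- by move=> u cu; exact: continuous_mulmx_rV.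
- rewrite -mulmxBl; apply: le_trans (norm_mulmx_le _ _) _.
  by rewrite ler_wpM2r// ler_wpM2l// /J clip_id// HC.
exists u => // t tT; have := du t tT; by rewrite /J clip_id.
Qed.

(** Gronwall is used twice. The difference [D] of the solutions through [h *: 'e_i + x] and [x] is
    of order [h]. Then [E = D - h *: u] starts at size [eta * |h|] and solves the variation equation
    up to an error [eta * |D|], by strict differentiability of [F] along the compact path; so [E] is
    at most [e * |h|]. *)
Lemma param_derive x T i (u : R -> 'rV[R]_m) : i != i0 -> O x -> 0 <= T ->
  T < rho -> u 0 = 'D_('e_i) phi0 (p x 0) ->
  (forall t : R, `|t| <= T -> is_derive t 1 u (u t *m jac F (phi (p x t)))) ->
  forall t, `|t| <= T -> is_derive (p x t) 'e_i phi (u t).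
Proof.
move=> ii0 Ox T0 Tr u0 du; have [C C0 HC] := jac_bound Ox Tr.
pose L := m%:R * C; have L0 : 0 <= L by rewrite mulr_ge0.
have LJ t (v : 'rV[R]_m) : `|t| <= T -> `|v *m jac F (phi (p x t))| <= L * `|v|.
  move=> tT; apply: le_trans (norm_mulmx_le _ _) _.
  by rewrite ler_wpM2r// ler_wpM2l// HC.
have L10 : 0 <= L + 1 by rewrite addr_ge0.
have [K K0 HK] := gronwall m T L10.
move=> t tT; apply: is_derive_of_bound => e e0.
pose C1 := `|'D_('e_i) phi0 (p x 0)| + 1.
have C10 : 0 < C1 by rewrite ltr_wpDl.
have D0 : 0 < K * (1 + K * C1).
  by rewrite mulr_gt0// addr_gt0// mulr_gt0.
(* The second Gronwall estimate ends with [K * (eta + eta * K * C1) * |h|], which has to be at most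
   [e * |h|]. The cap 1 lets the first one use the fixed Lipschitz constant [L + 1]. *)
pose eta := Num.min 1 (e / (K * (1 + K * C1))).
have eta0 : 0 < eta by rewrite lt_min ltr01 divr_gt0.
have eta1 : eta <= 1 by rewrite ge_min lexx.
have etae : eta * (K * (1 + K * C1)) <= e.
  by rewrite -ler_pdivlMr// ge_min lexx orbT.
have cK : compact (phi @` Kp x T).
  apply: continuous_compact; last exact: compact_path.
  apply: continuous_in_subspaceT => y; rewrite inE => -[s sT <-].
  by apply: cphi; exact: (path_sub Ox Tr sT).
have [|d1 d10 Hd1] := @compact_uniform _ _ (phi @` Kp x T)
    (fun a b => W b /\ `|F b - F a - (b - a) *m jac F a| <= eta * `|b - a|) cK.
  move=> _ [_ [s sT <-] <-]; apply: strict_differentiability => //.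
  by apply: phiW; exact: (path_sub Ox Tr sT).
have [d2 d20 Hd2] := uniform_on_path Ox Tr d10 cphi.
have p0O : O (p x 0) by apply: path_sub Tr _ => //; rewrite normr0.
have dphi0 : is_derive (p x 0) 'e_i phi0 ('D_('e_i) phi0 (p x 0)).
  apply: derivableP; apply/derivable_mxP => a j; rewrite ord1.
  by have [_ /(_ i)[dj _]] := Cphi0 j; exact: dj.
have [d3 d30 Hd3] := is_derive_bound dphi0 eta0.
exists (Num.min d2 d3); first by rewrite lt_min d20.
move=> h; rewrite lt_min => /andP[hd2 hd3].
have near_path s : `|s| <= T ->
    O (h *: 'e_i + p x s) /\ `|phi (h *: 'e_i + p x s) - phi (p x s)| < d1.
  move=> sT; apply: Hd2 => //; rewrite addrK normrZ; apply: le_lt_trans hd2.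
  by rewrite ler_piMr// norm_delta_le.
pose D (s : R) : 'rV[R]_m := phi (p (h *: 'e_i + x) s) - phi (p x s).
pose D' (s : R) : 'rV[R]_m := F (phi (p (h *: 'e_i + x) s)) - F (phi (p x s)).
have dD (s : R) : `|s| <= T -> is_derive s 1 D (D' s).
  move=> sT; apply: is_deriveB; apply: path_derive; last exact: (path_sub Ox Tr sT).
  by rewrite set_time_add//; have [] := near_path s sT.
have rD s : `|s| <= T -> `|D' s - D s *m jac F (phi (p x s))| <= eta * `|D s|.
  move=> sT; have [_ h1] := near_path s sT; rewrite /D /D' set_time_add//.
  apply: (Hd1 _ _ _ h1).2; exists (p x s) => //; by exists s.
have D_init : `|D 0| <= C1 * `|h|.
  have := Hd3 _ hd3; rewrite /D set_time_add// !phi_init ?set_time_coord//; last 2 first.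
  - by have [] := near_path 0 _; rewrite ?normr0.
  - by rewrite -set_time_add// set_time_coord.
  set A := phi0 _ - phi0 _ => HA; rewrite -[A](subrK (h *: 'D_('e_i) phi0 (p x 0))).
  apply: le_trans (ler_normD _ _) _; rewrite normrZ /C1 mulrDl mul1r addrC mulrC.
  by rewrite lerD2l; apply: le_trans HA _; rewrite ler_piMl.
have bD s : `|s| <= T -> `|D s| <= K * (C1 * `|h|).
  move=> sT.
  have D'b r : `|r| <= T -> `|D' r| <= (L + 1) * `|D r| + 0.
    move=> rT; rewrite addr0 -[D' r](subrK (D r *m jac F (phi (p x r)))).
    apply: le_trans (ler_normD _ _) _; rewrite mulrDl mul1r addrC.
    apply: lerD; first exact: LJ.
    by apply: le_trans (rD _ rT) _; rewrite ler_piMl.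
  apply: le_trans (HK D D' 0 (lexx _) dD D'b s sT) _; rewrite addr0.
  by rewrite ler_wpM2l// ltW.
pose E (s : R) : 'rV[R]_m := D s - h *: u s.
pose E' (s : R) : 'rV[R]_m := D' s - h *: (u s *m jac F (phi (p x s))).
have dE (s : R) : `|s| <= T -> is_derive s 1 E (E' s).
  by move=> sT; exact: is_deriveB (dD _ sT) (is_deriveZ h (du _ sT)).
have bE s : `|s| <= T -> `|E' s| <= (L + 1) * `|E s| + eta * (K * (C1 * `|h|)).
  move=> sT.
  have -> : E' s = E s *m jac F (phi (p x s)) + (D' s - D s *m jac F (phi (p x s))).
    have sub3 (a b d : 'rV[R]_m) : d - b = a - b + (d - a).
      by rewrite [RHS]addrC addrA subrK.
    by rewrite /E /E' mulmxBl -scalemxAl; exact: sub3.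
  apply: le_trans (ler_normD _ _) _; apply: lerD.
    by apply: le_trans (LJ _ _ sT) _; rewrite ler_wpM2r// lerDl.
  apply: le_trans (rD _ sT) _; apply: ler_wpM2l; [exact: ltW|exact: bD].
have eta20 : 0 <= eta * (K * (C1 * `|h|)) by rewrite !mulr_ge0// ltW.
have := HK E E' _ eta20 dE bE t tT; rewrite {1}/E /D set_time_add//.
move=> /le_trans; apply.
have E_init : `|E 0| <= eta * `|h|.
  have := Hd3 _ hd3; rewrite /E /D set_time_add// !phi_init ?set_time_coord ?u0//.
  - by have [] := near_path 0 _; rewrite ?normr0.
  - by rewrite -set_time_add// set_time_coord.
apply: le_trans (ler_wpM2l (ltW K0) (lerD E_init (lexx _))) _.
have -> : K * (eta * `|h| + eta * (K * (C1 * `|h|))) = eta * (K * (1 + K * C1)) * `|h|.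
  by ring.
by rewrite ler_wpM2r.
Qed.

(** [T < rho] keeps the closed time segment in [O], where compactness applies; [|x 0 i0| < T] is
    strict so that times near that of [x] are covered too. *)
Lemma enlarge_time x : O x ->
  exists T : R, [/\ 0 <= T, `|x 0 i0| < T & T < rho].
Proof.
move=> /O_lt xr; exists ((`|x 0 i0| + rho) / 2).
by have := normr_ge0 (x 0 i0); split; lra.
Qed.

Lemma param_is_derive x i : i != i0 -> O x ->
  is_derive x 'e_i phi ('D_('e_i) phi x).
Proof.
move=> ii0 Ox; have [T [T0 xT Tr]] := enlarge_time Ox.
have [u u0 du] := variation_exists i Ox T0 Tr.
have := param_derive ii0 Ox T0 Tr u0 du (ltW xT).
by rewrite set_time_id => -[d _]; exact: derivableP.
Qed.

Lemma variation_eq x i : i != i0 -> O x ->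
  is_derive x 'e_i0 ('D_('e_i) phi) ('D_('e_i) phi x *m jac F (phi x)).
Proof.
move=> ii0 Ox; have [T [T0 xT Tr]] := enlarge_time Ox.
have [u u0 du] := variation_exists i Ox T0 Tr.
have psiu t : `|t| <= T -> 'D_('e_i) phi (set_time i0 x t) = u t.
  by move=> tT; have [] := param_derive ii0 Ox T0 Tr u0 du tT.
apply: is_derive_of_set_time.
have := du _ (ltW xT); rewrite -psiu ?(ltW xT)// set_time_id.
apply: near_eq_is_derive; near=> t; rewrite psiu//.
by near: t; apply: (cvgr_norm_le (x 0 i0)) => //; exact: cvg_id.
Unshelve. all: by end_near. Qed.

Lemma variation_init x i : i != i0 -> O x -> x 0 i0 = 0 ->
  'D_('e_i) phi x = 'D_('e_i) phi0 x.
Proof.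
move=> ii0 Ox x0; have [T [T0 xT Tr]] := enlarge_time Ox.
have [u u0 du] := variation_exists i Ox T0 Tr.
have T0' : `|0 : R| <= T by rewrite normr0.
have [_] := param_derive ii0 Ox T0 Tr u0 du T0'; rewrite u0.
by rewrite -x0 set_time_id.
Qed.

(** The derivatives at [x] and [y] are values of solutions [u] and [v] of two linear equations with
    close coefficients and close initial values. Their difference solves the equation of [y] with
    the error [u] times the difference of the coefficients, so Gronwall applies; the difference in
    time is absorbed by continuity of [u]. *)
Lemma variation_continuous x i : i != i0 -> O x ->
  {for x, continuous ('D_('e_i) phi)}.
Proof.
move=> ii0 Ox; have [T [T0 xT Tr]] := enlarge_time Ox.
have [u u0 du] := variation_exists i Ox T0 Tr.
have psiu := param_derive ii0 Ox T0 Tr u0 du.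
have [C C0 HC] := jac_bound Ox Tr.
pose L := m%:R * (C + 1); have L0 : 0 <= L by rewrite mulr_ge0// addr_ge0.
have [K K0 HK] := gronwall m T L0.
have Ku t : `|t| <= T -> `|u t| <= K * `|u 0|.
  move=> tT; rewrite -[`|u 0|]addr0; apply: (HK u _ 0 (lexx _) du _ t tT) => s sT.
  rewrite addr0; apply: le_trans (norm_mulmx_le _ _) _.
  rewrite ler_wpM2r// ler_wpM2l//; apply: le_trans (HC _ sT) _.
  by rewrite lerDl.
pose Cu := K * `|u 0|; have Cu0 : 0 <= Cu by rewrite mulr_ge0// ltW.
apply: continuous_for_le => e e0.
pose D := K * (1 + m%:R * Cu); have D0 : 0 < D.
  by rewrite mulr_gt0// ltr_wpDr// mulr_ge0.
pose eta := Num.min 1 (e / 2 / D).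
have eta0 : 0 < eta by rewrite lt_min ltr01 !divr_gt0.
have eta1 : eta <= 1 by rewrite ge_min lexx.
have etaD : eta * D <= e / 2 by rewrite -ler_pdivlMr// ge_min lexx orbT.
have [d1 d10 Hd1] := uniform_on_path Ox Tr eta0 jac_phi_continuous.
have cphi0 y : O y -> {for y, continuous ('D_('e_i) phi0)}.
  move=> Oy; have C1 : Ck_on 1 O phi0 by apply/Ck_on_rV.
  by have [_ /(_ i)[_ [c _]]] := C1; exact: c.
have [d2 d20 Hd2] := uniform_on_path Ox Tr eta0 cphi0.
have cu : {for x 0 i0, continuous u} := is_derive_continuous (du _ (ltW xT)).
near=> y.
have yd1 : `|y - x| < d1 by near: y; exact: (near_dist_lt x d10).
have yd2 : `|y - x| < d2 by near: y; exact: (near_dist_lt x d20).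
have yT : `|y 0 i0| <= T.
  near: y; apply: (cvgr_norm_le (x 0 i0)) => //.
  exact: coord_continuous.
have ux : `|u (x 0 i0) - u (y 0 i0)| <= e / 2.
  near: y; apply: (cvgrPdist_le _ _).1; last by rewrite divr_gt0.
  by apply: (@continuous_comp _ _ _ (fun y : 'rV[R]_n => y 0 i0) u x) => //;
     exact: coord_continuous.
have Oy : O y by near: y; exact: open_nbhs_nbhs.
have [v v0 dv] := variation_exists i Oy T0 Tr.
have psiv := param_derive ii0 Oy T0 Tr v0 dv.
have psix : 'D_('e_i) phi x = u (x 0 i0).
  by have [_] := psiu _ (ltW xT); rewrite set_time_id.
have psiy : 'D_('e_i) phi y = v (y 0 i0).
  by have [_] := psiv _ yT; rewrite set_time_id.
rewrite psix psiy.
have Jd t : `|t| <= T ->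
    `|jac F (phi (set_time i0 y t)) - jac F (phi (set_time i0 x t))| <= eta.
  move=> tT; apply: ltW; apply: (Hd1 _ _ tT _).2.
  exact: le_lt_trans (set_time_dist _ _ _ _) yd1.
have Ed (t : R) : `|t| <= T -> is_derive t 1 (v - u)
   (v t *m jac F (phi (set_time i0 y t)) - u t *m jac F (phi (set_time i0 x t))).
  by move=> tT; exact: is_deriveB (dv _ tT) (du _ tT).
have Eb t : `|t| <= T ->
   `|v t *m jac F (phi (set_time i0 y t)) - u t *m jac F (phi (set_time i0 x t))|
   <= L * `|(v - u) t| + eta * (m%:R * Cu).
  move=> tT; rewrite -(subrKA (u t *m jac F (phi (set_time i0 y t)))).
  rewrite -mulmxBl -mulmxBr; apply: le_trans (ler_normD _ _) _.
  apply: lerD; apply: le_trans (norm_mulmx_le _ _) _.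
    rewrite ler_wpM2r// ler_wpM2l//.
    rewrite -[X in `|X|](subrK (jac F (phi (set_time i0 x t)))).
    apply: le_trans (ler_normD _ _) _; rewrite addrC lerD//; first exact: HC.
    exact: le_trans (Jd _ tT) eta1.
  rewrite -mulrA [leRHS]mulrCA ler_wpM2l//.
  by apply: ler_pM => //; [exact: Jd|exact: Ku].
have eC : 0 <= eta * (m%:R * Cu) by rewrite !mulr_ge0// ltW.
have := HK _ _ _ eC Ed Eb _ yT; rewrite -[(v - u) 0]/(v 0 - u 0) v0 u0.
have : `|'D_('e_i) phi0 (set_time i0 y 0) - 'D_('e_i) phi0 (set_time i0 x 0)| <= eta.
  apply: ltW; apply: (Hd2 _ _ _ _).2; first by rewrite normr0.
  exact: le_lt_trans (set_time_dist _ _ _ _) yd2.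
move=> h1 h2; rewrite -(subrKA (u (y 0 i0))); apply: le_trans (ler_normD _ _) _.
rewrite [e]splitr lerD// distrC; apply: le_trans h2 _; apply: le_trans etaD.
rewrite /D [leRHS]mulrCA; apply: ler_wpM2l; first exact: ltW.
by rewrite [leRHS]mulrDr mulr1 lerD2r.
Unshelve. all: by end_near. Qed.

End ParameterDerivative.

Section SmoothDependence.
Context {R : realType} {n : nat}.
Variables (i0 : 'I_n) (rho : R) (O : set 'rV[R]_n).
Hypotheses (oO : open O)
  (O_lt : forall x, O x -> `|x 0 i0| < rho)
  (O_time : forall x t, O x -> `|t| < rho -> O (set_time i0 x t)).

Lemma Ck_on_lsubmx k p q (W : set 'rV[R]_(p + q)) j :
  Ck_on k W (fun w => lsubmx w 0 j).
Proof.
have -> : (fun w : 'rV[R]_(p + q) => lsubmx w 0 j) = fun w => w 0 (lshift q j).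
  by apply/funext => w; rewrite mxE.
exact: Ck_on_coord.
Qed.

Lemma Ck_on_rsubmx k p q (W : set 'rV[R]_(p + q)) j :
  Ck_on k W (fun w => rsubmx w 0 j).
Proof.
have -> : (fun w : 'rV[R]_(p + q) => rsubmx w 0 j) = fun w => w 0 (rshift p j).
  by apply/funext => w; rewrite mxE.
exact: Ck_on_coord.
Qed.

Lemma open_lsubmx p q (W : set 'rV[R]_p) :
  open W -> open (lsubmx @^-1` W : set 'rV[R]_(p + q)).
Proof.
move=> oW; apply: open_comp => // w _; apply: differentiable_continuous.
exact: differentiable_lsubmx.
Qed.

(* Induction on [k], for all dimensions at once: if [phi] solves
   [d_i0 phi = F(phi)] then [(phi, d_i phi)] solves the equation of the same
   type given by the first variation of [F]. *)
Theorem Ck_on_solution k m (W : set 'rV[R]_m) (F : 'rV[R]_m -> 'rV[R]_m)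
    (phi phi0 : 'rV[R]_n -> 'rV[R]_m) :
  open W -> (forall x, O x -> W (phi x)) ->
  (forall j, smooth_on W (fun w => F w 0 j)) ->
  (forall x, O x -> {for x, continuous phi}) ->
  (forall x, O x -> is_derive x 'e_i0 phi (F (phi x))) ->
  (forall j, smooth_on O (fun x => phi0 x 0 j)) ->
  (forall x, O x -> x 0 i0 = 0 -> phi x = phi0 x) ->
  Ck_on k O phi.
Proof.
elim: k m W F phi phi0 => [|k IH] m W F phi phi0 oW phiW CF cphi dphi Cphi0 phi_init.
  by split.
have Ck_phi : Ck_on k O phi := IH m W F phi phi0 oW phiW CF cphi dphi Cphi0 phi_init.
have CF1 j : Ck_on 1 W (fun w => F w 0 j) by exact: CF.
have C01 j : Ck_on 1 O (fun x => phi0 x 0 j) by exact: Cphi0.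
(* Along the time the derivative is [F (phi x)], already C^k by composition. The other directions
   require the enlarged system. *)
split=> // i; have [->|ii0] := eqVneq i i0.
  split; first by move=> x Ox; have [] := dphi _ Ox.
  have CFphi : Ck_on k O (fun x => F (phi x)).
    apply/(Ck_on_rV _ _ oO) => j.
    apply: (Ck_on_comp oO oW phiW (CF j k)).
    exact: (Ck_on_rV _ _ oO).1.
  by apply: (Ck_on_eq oO _ CFphi) => x Ox; have [_ ->] := dphi _ Ox.
have dpsi x (Ox : O x) :=
  param_is_derive oO O_lt O_time oW phiW CF1 cphi dphi C01 phi_init ii0 Ox.
split; first by move=> x /dpsi[].
pose psi := 'D_('e_i) phi.
pose phi2 x : 'rV[R]_(m + m) := row_mx (phi x) (psi x).
pose phi02 x : 'rV[R]_(m + m) := row_mx (phi0 x) ('D_('e_i) phi0 x).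
pose F2 w : 'rV[R]_(m + m) :=
  row_mx (F (lsubmx w)) (rsubmx w *m jac F (lsubmx w)).
pose W2 : set 'rV[R]_(m + m) := lsubmx @^-1` W.
have oW2 : open W2 by exact: open_lsubmx.
have Cphi0' : forall l, Ck_on l O phi0.
  by move=> l; apply/(Ck_on_rV _ _ oO) => j; exact: Cphi0.
have : Ck_on k O phi2.
  apply: (IH _ W2 F2 phi2 phi02 oW2).
  - by move=> x Ox; rewrite /W2 /phi2 /= row_mxKl; exact: phiW.
  - move=> j l; case: (split_ordP j) => a ->.
      have -> : (fun w => F2 w 0 (lshift m a)) = fun w => F (lsubmx w) 0 a.
        by apply/funext => w; rewrite row_mxEl.
      apply: (@Ck_on_comp _ _ _ _ W2 W (fun w => F w 0 a) lsubmx) => //.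
        exact: CF.
      by move=> b; exact: Ck_on_lsubmx.
    have -> : (fun w => F2 w 0 (rshift m a)) =
        fun w => \sum_b rsubmx w 0 b * 'D_('e_b) (fun w => F w 0 a) (lsubmx w).
      apply/funext => w; rewrite row_mxEr mxE.
      by apply: eq_bigr => b _; rewrite [jac _ _ _ _]mxE.
    apply: (Ck_on_sum _ _ oW2) => b; apply: (Ck_onM oW2); first exact: Ck_on_rsubmx.
    apply: (@Ck_on_comp _ _ _ _ W2 W ('D_('e_b) (fun w => F w 0 a)) lsubmx) => //.
      by have [_ /(_ b)[]] := CF a l.+1.
    by move=> c; exact: Ck_on_lsubmx.
  - move=> x Ox; apply: continuous_rV => j; case: (split_ordP j) => a ->.
      have -> : (fun y => phi2 y 0 (lshift m a)) = fun y => phi y 0 a.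
        by apply/funext => y; rewrite row_mxEl.
      exact: (continuous_coord (cphi _ Ox)).
    have -> : (fun y => phi2 y 0 (rshift m a)) = fun y => psi y 0 a.
      by apply/funext => y; rewrite row_mxEr.
    apply: continuous_coord.
    exact: (variation_continuous oO O_lt O_time oW phiW CF1 cphi dphi C01 phi_init ii0 Ox).
  - move=> x Ox; apply: is_derive_rV => j; case: (split_ordP j) => a ->.
      have -> : (fun y => phi2 y 0 (lshift m a)) = fun y => phi y 0 a.
        by apply/funext => y; rewrite row_mxEl.
      by rewrite row_mxEl row_mxKl; apply: is_derive_coord_rV; exact: dphi.
    have -> : (fun y => phi2 y 0 (rshift m a)) = fun y => psi y 0 a.
      by apply/funext => y; rewrite row_mxEr.
    rewrite row_mxEr row_mxKl row_mxKr; apply: is_derive_coord_rV.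
    exact: (variation_eq oO O_lt O_time oW phiW CF1 cphi dphi C01 phi_init ii0 Ox).
  - move=> j l; case: (split_ordP j) => a ->.
      have -> : (fun y => phi02 y 0 (lshift m a)) = fun y => phi0 y 0 a.
        by apply/funext => y; rewrite row_mxEl.
      exact: Cphi0.
    have -> : (fun y => phi02 y 0 (rshift m a)) = fun y => 'D_('e_i) phi0 y 0 a.
      by apply/funext => y; rewrite row_mxEr.
    by have [_ /(_ i)[_ C]] := Cphi0' l.+1; exact: (Ck_on_rV _ _ oO).1 C a.
  - move=> x Ox x0; apply: (congr2 row_mx (phi_init _ Ox x0)).
    exact: (variation_init oO O_lt O_time oW phiW CF1 cphi dphi C01 phi_init ii0 Ox).
move=> /(Ck_on_rV _ _ oO) C2; apply/(Ck_on_rV _ _ oO) => j.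
apply: (Ck_on_eq oO _ (C2 (rshift m j))) => x _.
by rewrite row_mxEr.
Qed.

End SmoothDependence.

(** * Local flows of smooth vector fields *)

Section LocalFlow.
Context {R : realType} {n : nat}.
Implicit Types (x y p : 'rV[R]_n) (s t : R).

Definition clip_box p (d : R) x : 'rV[R]_n :=
  \row_j (p 0 j + clip d (x 0 j - p 0 j)).

Lemma clip_box_dist p d x : 0 <= d -> `|clip_box p d x - p| <= d.
Proof.
move=> d0; apply: norm_rV_le => // j; rewrite !mxE addrAC subrr add0r.
exact: clip_le.
Qed.

Lemma clip_box_id p d x : `|x - p| <= d -> clip_box p d x = x.
Proof.
move=> xp; apply/rowP => j; rewrite mxE clip_id ?subrKC//.
by apply: le_trans xp; apply: le_trans (le_coord_norm _ j); rewrite !mxE.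
Qed.

Lemma clip_box_lipschitz p d x y : `|clip_box p d x - clip_box p d y| <= `|x - y|.
Proof.
apply: norm_rV_le => // j; rewrite !mxE opprD addrACA subrr add0r.
apply: le_trans (clip_lipschitz _ _ _) _; rewrite opprB addrA subrK.
by apply: le_trans (le_coord_norm _ j); rewrite !mxE.
Qed.

(** Strict differentiability with [e = 1] bounds the deviation from the linear part, and the
    Jacobian matrix is bounded near [p]; the two bounds add up to the Lipschitz constant. *)
Lemma locally_lipschitz (U : set 'rV[R]_n) (Z : 'rV[R]_n -> 'rV[R]_n) p :
  open U -> (forall j, Ck_on 1 U (fun x => Z x 0 j)) -> U p ->
  exists d L : R, [/\ 0 < d, 0 <= L, (forall x, `|x - p| <= d -> U x) &
    forall x y, `|x - p| <= d -> `|y - p| <= d -> `|Z x - Z y| <= L * `|x - y|].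
Proof.
move=> oU CZ Up.
have [d d0 Hd] := strict_differentiability oU CZ Up ltr01.
have Jp : `|jac Z p| < `|jac Z p| + 1 by rewrite ltrDl.
have /nbhs0_normP[d' d'0 Hd'] : \forall x \near p, `|jac Z x| <= `|jac Z p| + 1.
  exact: (cvgr_norm_le (jac Z p) (jac_continuous CZ Up)).
have dm : 0 < Num.min d d' by rewrite lt_min d0.
have lt_d x : `|x - p| <= Num.min d d' / 2 -> `|x - p| < d /\ `|x - p| < d'.
  move=> xp; have : `|x - p| < Num.min d d' by lra.
  by rewrite lt_min => /andP[].
exists (Num.min d d' / 2), (n%:R * (`|jac Z p| + 1) + 1); split.
- by rewrite divr_gt0.
- by rewrite addr_ge0// mulr_ge0// addr_ge0.
- by move=> x /lt_d[xd _]; have [] := Hd _ _ xd xd.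
move=> x y /lt_d[xd _] /lt_d[yd yd'].
have [_] := Hd _ _ yd xd; rewrite mul1r => h1.
rewrite -[Z x - Z y](subrK ((x - y) *m jac Z y)); apply: le_trans (ler_normD _ _) _.
rewrite mulrDl mul1r addrC lerD//; apply: le_trans (norm_mulmx_le _ _) _.
by rewrite ler_wpM2r// ler_wpM2l// Hd'.
Qed.

Lemma comp_curve (f : 'rV[R]_n -> R) (g : R -> 'rV[R]_n) t dg :
  differentiable f (g t) -> is_derive t 1 g dg ->
  is_derive t 1 (fun s => f (g s)) ('D_dg f (g t)).
Proof.
move=> df [dgt <-]; have dg' : differentiable g t by exact/derivable1_diffP.
have D : differentiable (f \o g) t by exact: differentiable_comp.
apply: DeriveDef; first exact: diff_derivable.
rewrite -[LHS]/('D_1 (f \o g) t) (deriveE _ D) diff_comp//= (deriveE _ df).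
by rewrite (deriveE _ dg').
Qed.

(* The vector field is composed with the projection onto a small box around [p];
   the result is globally Lipschitz, so that its flow is global in space. *)
Theorem local_flow (U : set 'rV[R]_n) (Z : 'rV[R]_n -> 'rV[R]_n) p :
  open U -> (forall j, smooth_on U (fun x => Z x 0 j)) -> U p ->
  exists (rho B : R) (Phi : R -> 'rV[R]_n -> 'rV[R]_n),
    [/\ 0 < rho /\ 0 <= B, forall y, Phi 0 y = y,
      forall t y, `|t| < rho -> `|y - p| < rho ->
        U (Phi t y) /\ is_derive t 1 (Phi^~ y) (Z (Phi t y)),
      smooth_on [set z : 'rV[R]_(1 + n) | `|z - row_mx 0 p| < rho]
        (fun z => Phi (z 0 (lshift n 0)) (rsubmx z)) &
      [/\ forall s t y, `|s| < rho -> `|t| < rho -> Phi t (Phi s y) = Phi (s + t) y,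
        forall t y, `|t| < rho -> `|Phi t y - y| <= B * `|t| &
        forall j c t y, (forall x, U x -> Z x 0 j = c) -> `|t| < rho ->
          Phi t y 0 j = y 0 j + c * t]].
Proof.
move=> oU CZ Up; have CZ1 j : Ck_on 1 U (fun x => Z x 0 j) by exact: CZ.
have [d [L [d0 L0 dU lipZ]]] := locally_lipschitz oU CZ1 Up.
pose Zc x := Z (clip_box p d x).
have clip_d x : `|clip_box p d x - p| <= d by exact: clip_box_dist (ltW d0).
have lipZc x y : `|Zc x - Zc y| <= L * `|x - y|.
  apply: le_trans (lipZ _ _ (clip_d x) (clip_d y)) _.
  by rewrite ler_wpM2l// clip_box_lipschitz.
pose B := `|Z p| + L * d; have B0 : 0 <= B by rewrite addr_ge0// mulr_ge0// ltW.
have bZc x : `|Zc x| <= B.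
  rewrite -[Zc x](subrK (Z p)) addrC; apply: le_trans (ler_normD _ _) _.
  have pp : `|p - p| <= d by rewrite subrr normr0 ltW.
  rewrite lerD2l; apply: le_trans (lipZ _ _ (clip_d x) pp) _.
  by rewrite ler_wpM2l.
have cZc : continuous Zc.
  move=> x; apply: continuous_for_le => e e0.
  have L1 : 0 < L + 1 by rewrite ltr_wpDl.
  have eL : 0 < e / (L + 1) by rewrite divr_gt0.
  have := near_dist_lt x eL; apply: filterS => y xy.
  apply: le_trans (lipZc _ _) _; rewrite distrC.
  have : (L + 1) * `|y - x| < e by rewrite mulrC -ltr_pdivlMr.
  by have := normr_ge0 (y - x); lra.
have /choice[Psi HPsi] y : exists u : R -> 'rV[R]_n,
    u 0 = y /\ forall t : R, `|t| <= 1 -> is_derive t 1 u (Zc (u t)).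
  have [|t v w _|u u0 du] := @picard _ n (fun _ => Zc) L 1 y L0 ler01; last by exists u.
    by move=> u cu t; apply: continuous_comp; [exact: cu|exact: cZc].
  exact: lipZc.
pose Phi t y := Psi y t.
have Phi0 y : Phi 0 y = y by exact: (HPsi y).1.
have dPhi (t : R) y : `|t| <= 1 -> is_derive t 1 (Phi^~ y) (Zc (Phi t y)).
  exact: (HPsi y).2.
have [K K0 HK] := gronwall n 1 L0.
(* The interval is left variable because the group law compares solutions only for
   [|t| <= 1 - |s|]. *)
have uniq (T : R) (u v : R -> 'rV[R]_n) : T <= 1 -> u 0 = v 0 ->
    (forall t : R, `|t| <= T -> is_derive t 1 u (Zc (u t))) ->
    (forall t : R, `|t| <= T -> is_derive t 1 v (Zc (v t))) ->
    forall t, `|t| <= T -> u t = v t.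
  move=> T1 uv du dv t tT; apply/eqP; rewrite -subr_eq0 -normr_le0.
  have [K' _ HK'] := gronwall n T L0.
  have d' (s : R) : `|s| <= T -> is_derive s 1 (u - v) (Zc (u s) - Zc (v s)).
    by move=> sT; exact: is_deriveB (du _ sT) (dv _ sT).
  have b' s : `|s| <= T -> `|Zc (u s) - Zc (v s)| <= L * `|(u - v) s| + 0.
    by move=> _; rewrite addr0; exact: lipZc.
  have := HK' _ _ 0 (lexx 0) d' b' t tT.
  by rewrite -[(u - v) 0]/(u 0 - v 0) uv subrr normr0 addr0 mulr0.
have move_le t y : `|t| <= 1 -> `|Phi t y - y| <= B * `|t|.
  move=> t1; pose b := B * dirsg t.
  have d1 (s : R) : `|s| <= `|t| -> is_derive s 1 (Phi^~ y) (Zc (Phi s y)).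
    by move=> st; apply: dPhi; exact: le_trans t1.
  have d2 (s : R) : `|s| <= `|t| -> is_derive s 1 (b \*: (@id R)) b.
    move=> _; have := is_deriveZ b (is_derive_id s (1 : R)).
    by rewrite [b *: 1]mulr1.
  have H (s : R) : `|s| <= `|t| -> 0 <= s * t -> `|Zc (Phi s y)| * `|t| <= b * t.
    by move=> _ _; rewrite /b -mulrA dirsg_norm ler_wpM2r.
  have := MVT_le d1 d2 H; rewrite Phi0 => /le_trans; apply.
  rewrite -[(b \*: id) t]/(b * t) -[(b \*: id) 0]/(b * 0) mulr0 subr0.
  by rewrite /b -mulrA dirsg_norm.
have dep_le t x y : `|t| <= 1 -> `|Phi t x - Phi t y| <= K * `|x - y|.
  move=> t1.
  have d' (s : R) : `|s| <= 1 ->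
      is_derive s 1 (Phi^~ x - Phi^~ y) (Zc (Phi s x) - Zc (Phi s y)).
    by move=> s1; exact: is_deriveB (dPhi _ _ s1) (dPhi _ _ s1).
  have b' s : `|s| <= 1 ->
      `|Zc (Phi s x) - Zc (Phi s y)| <= L * `|(Phi^~ x - Phi^~ y) s| + 0.
    by move=> _; rewrite addr0; exact: lipZc.
  have := HK _ _ 0 (lexx 0) d' b' t t1.
  by rewrite -[(Phi^~ x - Phi^~ y) 0]/(Phi 0 x - Phi 0 y) !Phi0 addr0.
(* The bound 1/2 keeps [s + t] in [[-1, 1]], where the flow is defined by its equation. The bound
   [d / (B + 1)] keeps the trajectories in the box on which [Zc] coincides with [Z]. *)
pose rho := Num.min (1 / 2) (d / (B + 1)).
have B1 : 0 < B + 1 by rewrite ltr_wpDl.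
have rho0 : 0 < rho by rewrite lt_min divr_gt0// divr_gt0.
have rho2 : rho <= 1 / 2 by rewrite ge_min lexx.
have rhod : (B + 1) * rho <= d by rewrite mulrC -ler_pdivlMr// ge_min lexx orbT.
have near_p t y : `|t| < rho -> `|y - p| < rho -> `|Phi t y - p| < d.
  move=> tr yr; rewrite -(subrKA y); apply: le_lt_trans (ler_normD _ _) _.
  have t1 : `|t| <= 1 by lra.
  have := move_le t y t1; have := ler_wpM2l B0 (ltW tr); lra.
have dZ (t : R) y : `|t| < rho -> `|y - p| < rho ->
    is_derive t 1 (Phi^~ y) (Z (Phi t y)).
  move=> tr yr; have t1 : `|t| <= 1 by lra.
  have := dPhi t y t1; rewrite /Zc clip_box_id//; apply: ltW; exact: near_p.
exists rho, B, Phi; split => //.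
- move=> t y tr yr; split; last exact: dZ.
  by apply: dU; apply: ltW; exact: near_p.
(* Time becomes a coordinate, so joint regularity is that of a solution with initial value
   [rsubmx z]. A ball of the sup norm is a product, hence stable under changes of time within
   [rho]. *)
- pose i0 : 'I_(1 + n) := lshift n 0.
  pose c : 'rV[R]_(1 + n) := row_mx 0 p.
  pose O := [set x : 'rV[R]_(1 + n) | `|x - c| < rho].
  have ball_O : O = ball c rho.
    by apply/seteqP; split => x; rewrite /O -ball_normE/= distrC.
  have oO : open O by rewrite ball_O; exact: ball_open.
  have O0 (x : 'rV[R]_(1 + n)) : O x -> `|x 0 i0| < rho.
    move=> xc; apply: le_lt_trans xc; apply: le_trans (le_coord_norm _ i0).
    by rewrite !mxE /i0; case: split_ordP => // k; rewrite mxE subr0.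
  have Or (x : 'rV[R]_(1 + n)) : O x -> `|rsubmx x - p| < rho.
    move=> xc; apply: le_lt_trans xc; apply: norm_rV_le => // j.
    have <- : (x - c) 0 (rshift 1 j) = (rsubmx x - p) 0 j.
      rewrite mxE [in RHS]mxE [(- c) 0 _]mxE [(- p) 0 _]mxE /c row_mxEr.
      by rewrite [rsubmx x 0 j]mxE.
    exact: le_coord_norm.
  have O_time (x : 'rV[R]_(1 + n)) t : O x -> `|t| < rho -> O (set_time i0 x t).
    move=> Ox tr; rewrite /O/=; apply: norm_rV_lt => // j.
    rewrite 2![in X in X < _]mxE; case: eqP => [->|_].
      by rewrite [(- c) 0 i0]mxE /i0 /c row_mxEl mxE subr0.
    have -> : x 0 j + (- c) 0 j = (x - c) 0 j by rewrite [RHS]mxE.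
    exact: le_lt_trans (le_coord_norm _ j) Ox.
  have time_r (x : 'rV[R]_(1 + n)) t : rsubmx (set_time i0 x t) = rsubmx x.
    by apply/rowP => j; rewrite !mxE; case: eqP => // /eqP; rewrite eq_rlshift.
  pose W : set 'rV[R]_n := ball p d.
  have WU x : W x -> `|x - p| < d by rewrite /W -ball_normE/= distrC.
  move=> k.
  apply: (@Ck_on_solution _ _ i0 rho O oO O0 O_time k n W Z _ (fun z => rsubmx z)).
  + exact: ball_open.
  + move=> x Ox; rewrite /W -ball_normE/= distrC; apply: near_p; [exact: O0|exact: Or].
  + move=> j l; apply: Ck_on_sub (CZ j l) => x /WU xd; apply: dU; exact: ltW.
  + move=> x Ox; apply: continuous_for_le => e e0.
    have x1 : `|x 0 i0| <= 1 by have := O0 _ Ox; lra.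
    have K1 : 0 < K + 1 by rewrite addr_gt0.
    have eK : 0 < e / 2 / (K + 1) by rewrite !divr_gt0.
    have ct : {for x 0 i0, continuous (Phi^~ (rsubmx x))} :=
      is_derive_continuous (dPhi _ _ x1).
    near=> z.
    have h1 : `|Phi (x 0 i0) (rsubmx x) - Phi (z 0 i0) (rsubmx x)| <= e / 2.
      near: z; apply: (cvgrPdist_le _ _).1; last by rewrite divr_gt0.
      by apply: (@continuous_comp _ _ _ (fun z : 'rV[R]_(1 + n) => z 0 i0)
        (Phi^~ (rsubmx x)) x) => //; exact: coord_continuous.
    have h2 : `|z - x| < e / 2 / (K + 1) by near: z; exact: (near_dist_lt x eK).
    have h3 : O z by near: z; exact: open_nbhs_nbhs.
    have h4 : `|rsubmx x - rsubmx z| <= `|z - x|.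
      rewrite distrC; apply: norm_rV_le => // j.
      have := le_coord_norm (z - x) (rshift 1 j); by rewrite !mxE.
    have z1 : `|z 0 i0| <= 1 by have := O0 _ h3; lra.
    have h5 := dep_le _ (rsubmx x) (rsubmx z) z1.
    rewrite -(subrKA (Phi (z 0 i0) (rsubmx x))); apply: le_trans (ler_normD _ _) _.
    rewrite [e]splitr lerD//; apply: le_trans h5 _.
    have h6 : (K + 1) * `|z - x| < e / 2 by rewrite mulrC -ltr_pdivlMr.
    have h7 := ler_wpM2l (ltW K0) h4; have := normr_ge0 (z - x); lra.
  + move=> x Ox; apply: is_derive_of_set_time.
    have -> : (fun s => Phi (set_time i0 x s 0 (lshift n 0)) (rsubmx (set_time i0 x s)))
        = Phi^~ (rsubmx x).
      by apply/funext => s; rewrite time_r -/i0 set_time_coord.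
    by apply: dZ; [exact: O0|exact: Or].
  + by move=> j l; exact: Ck_on_rsubmx.
  + by move=> x Ox x0; rewrite -/i0 x0 Phi0.
- split => //.
  + move=> s t y sr tr.
    have T1 : 1 - `|s| <= 1 by rewrite gerBl.
    pose v r := Phi (s + r) y.
    have v0 : Phi 0 (Phi s y) = v 0 by rewrite Phi0 /v addr0.
    apply: (uniq _ (Phi^~ (Phi s y)) v T1 v0) => [r rT|r rT|]; last by lra.
      by apply: dPhi; have := normr_ge0 s; lra.
    have sr1 : `|s + r| <= 1 by apply: le_trans (ler_normD _ _) _; lra.
    have [D E] := dPhi _ y sr1.
    exact: is_derive_eq (@translate_is_derive _ R^o _ (Phi^~ y) s r 1 D) E.
  + by move=> t y tr; apply: move_le; lra.
  (* [Zc] only takes values of [Z] on [U], so a constant component stays constant along every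
     trajectory, wherever [y] is. The cases [c = 1] and [c = 0] will control the slices. *)
  + move=> j c t y Zj tr.
    have d1 (s : R) : `|s| <= `|t| ->
        is_derive s 1 ((fun s => Phi s y 0 j) - c \*: (@id R)) 0.
      move=> st; have s1 : `|s| <= 1 by lra.
      have H1 := is_derive_coord_rV j (dPhi _ y s1).
      have H2 := is_deriveZ c (is_derive_id s (1 : R)).
      apply: is_derive_eq (is_deriveB H1 H2) _.
      by rewrite /Zc Zj; [rewrite [c *: 1]mulr1 subrr|exact: dU].
    have [s _] := MVT_sym d1; rewrite mul0r.
    move=> E; have {}E : Phi t y 0 j - c * t - (Phi 0 y 0 j - c * 0) = 0 := E.
    by rewrite Phi0 mulr0 subr0 in E; lra.
Unshelve. all: by end_near. Qed.

End LocalFlow.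

(** * First integrals of involutive distributions *)

Section FirstIntegrals.
Context {R : realType} {n : nat}.
Implicit Types (U V : set 'rV[R]_n) (X Y Z : 'rV[R]_n -> 'rV[R]_n)
  (f g w : 'rV[R]_n -> R) (x y z p : 'rV[R]_n).

Lemma smooth_derive U f v x : open U -> smooth_on U f -> U x ->
  derivable f x v.
Proof.
by move=> oU Cf Ux; apply: diff_derivable; exact: Ck_on_differentiable oU (Cf 1%N) Ux.
Qed.

Lemma smooth_vf_derive U X v x : open U ->
  (forall j, smooth_on U (fun x => X x 0 j)) -> U x -> derivable X x v.
Proof.
move=> oU CX Ux; apply/derivable_mxP => a j; rewrite ord1.
exact: smooth_derive oU (CX j) Ux.
Qed.

Lemma smooth_partial U f i : smooth_on U f -> smooth_on U ('D_('e_i) f).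
Proof. by move=> Cf k; have [_ /(_ i)[_]] := Cf k.+1. Qed.

Lemma vf_appE U X f x : open U -> smooth_on U f -> U x ->
  vf_app X f x = \sum_j X x 0 j * 'D_('e_j) f x.
Proof. by move=> oU Cf Ux; rewrite /vf_app (Ck_on_derive _ oU (Cf 1%N) Ux). Qed.

Lemma smooth_vf_app U X f : open U ->
  (forall j, smooth_on U (fun x => X x 0 j)) -> smooth_on U f ->
  smooth_on U (vf_app X f).
Proof.
move=> oU CX Cf k.
have H : Ck_on k U (fun x => \sum_j X x 0 j * 'D_('e_j) f x).
  apply: (Ck_on_sum _ _ oU) => j; apply: (Ck_onM oU); first exact: CX.
  exact: smooth_partial.
by apply: (Ck_on_eq oU _ H) => x Ux; rewrite (vf_appE _ oU Cf Ux).
Qed.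

Lemma derive_sum_mul U (r : nat) (a b : 'I_r -> 'rV[R]_n -> R) v x : open U ->
  (forall j, smooth_on U (a j)) -> (forall j, smooth_on U (b j)) -> U x ->
  'D_v (fun y => \sum_j a j y * b j y) x =
  \sum_j ('D_v (a j) x * b j x + a j x * 'D_v (b j) x).
Proof.
move=> oU Ca Cb Ux.
have -> : (fun y => \sum_j a j y * b j y) = \sum_j (a j * b j).
  by apply/funext => y; rewrite fct_sumE.
have da j := @smooth_derive U (a j) v x oU (Ca j) Ux.
have db j := @smooth_derive U (b j) v x oU (Cb j) Ux.
rewrite derive_sum; last by move=> j; exact: (derivableM (da j) (db j)).
apply: eq_bigr => j _; rewrite (deriveM (da j) (db j)) addrC.
by congr (_ + _); rewrite mulrC.
Qed.

(** Each iterated derivative splits into a first order and a second order part; the second order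
    parts agree by symmetry of second derivatives, and the first order parts make up the bracket. *)
Lemma bracket_apply U X Y f x : open U ->
  (forall j, smooth_on U (fun x => X x 0 j)) ->
  (forall j, smooth_on U (fun x => Y x 0 j)) -> smooth_on U f -> U x ->
  vf_app (lie_bracket X Y) f x = vf_app X (vf_app Y f) x - vf_app Y (vf_app X f) x.
Proof.
move=> oU CX CY Cf Ux.
have E (A B : 'rV[R]_n -> 'rV[R]_n) : (forall j, smooth_on U (fun x => A x 0 j)) ->
    (forall j, smooth_on U (fun x => B x 0 j)) ->
    vf_app A (vf_app B f) x =
    \sum_j 'D_(A x) (fun y => B y 0 j) x * 'D_('e_j) f x +
    \sum_j \sum_i B x 0 j * (A x 0 i * 'D_('e_i) ('D_('e_j) f) x).
  move=> CA CB; rewrite /vf_app.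
  have -> : 'D_(A x) (fun y => 'D_(B y) f y) x =
      'D_(A x) (fun y => \sum_j B y 0 j * 'D_('e_j) f y) x.
    apply: near_eq_derive; apply: (near_open oU Ux) => y Uy.
    by rewrite (Ck_on_derive _ oU (Cf 1%N) Uy).
  have CDf j := smooth_partial j Cf.
  apply: etrans (@derive_sum_mul U n (fun j y => B y 0 j) (fun j => 'D_('e_j) f)
    (A x) x oU CB CDf Ux) _.
  have S (F G : 'I_n -> R) : \sum_j (F j + G j) = \sum_j F j + \sum_j G j.
    by rewrite big_split.
  apply: etrans (S _ _) _.
  congr (_ + _); apply: eq_bigr => j _.
  by rewrite -mulr_sumr (Ck_on_derive _ oU (CDf j 1%N) Ux).
rewrite (E X Y CX CY) (E Y X CY CX) (vf_appE _ oU Cf Ux).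
have -> : \sum_j \sum_i X x 0 j * (Y x 0 i * 'D_('e_i) ('D_('e_j) f) x) =
    \sum_j \sum_i Y x 0 j * (X x 0 i * 'D_('e_i) ('D_('e_j) f) x).
  rewrite exchange_big; apply: eq_bigr => i _; apply: eq_bigr => j _.
  by rewrite mulrCA (derive_commute _ _ oU (Cf 2%N) Ux).
rewrite opprD addrACA subrr addr0 -sumrB; apply: eq_bigr => j _.
rewrite -mulrBl /lie_bracket; congr (_ * _).
by rewrite !mxE !derive_mx ?mxE//; exact: smooth_vf_derive oU _ Ux.
Qed.

Lemma derive_along_line f g x v :
  (forall h : R, f (h *: v + x) = g (h *: v + x)) -> 'D_v f x = 'D_v g x.
Proof.
move=> fg; rewrite /derive; congr (lim (_ @ 0^')); apply/funext => h /=.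
by rewrite fg; congr (_ *: (_ - _)); have := fg 0; rewrite scale0r add0r.
Qed.

(* [w'] is [w] composed with the projection [pi] onto the slice
   [x_a = p_a] along the flow of [Z]. *)
Lemma project_along_flow V Z p (a : 'I_n) w : open V -> V p ->
  (forall j, smooth_on V (fun x => Z x 0 j)) ->
  (forall x, V x -> Z x 0 a = 1) -> smooth_on V w ->
  exists (V' : set 'rV[R]_n) w' (pi : 'rV[R]_n -> 'rV[R]_n),
  [/\ [/\ open V', V' p & V' `<=` V], smooth_on V' w',
    forall x, V' x -> vf_app Z w' x = 0,
    forall x, V' x -> x 0 a = p 0 a -> w' x = w x &
    forall x, V' x ->
    [/\ V (pi x), pi x 0 a = p 0 a,
      forall j, (forall z, V z -> Z z 0 j = 0) -> pi x 0 j = x 0 j &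
      forall Y, (forall j, smooth_on V (fun x => Y x 0 j)) ->
        (forall z, V z -> Y z 0 a = 0) ->
        (forall z, V z -> lie_bracket Z Y z = 0) ->
        vf_app Y w (pi x) = 0 -> vf_app Y w' x = 0]].
Proof.
move=> oV Vp CZ Za Cw.
have [rho [B [Phi [[rho0 B0] Phi0 dPhi CPhi [PhiD Phi_le Phi_coord]]]]] :=
  local_flow oV CZ Vp.
pose W : set 'rV[R]_n := ball p rho.
have WE x : W x = (`|x - p| < rho) by rewrite /W -ball_normE/= distrC.
have oW : open W by exact: ball_open.
have WV : W `<=` V.
  move=> x; rewrite WE => xp; rewrite -[x]Phi0.
  by have [] := dPhi 0 x; rewrite ?normr0.
have time_lt x : `|p 0 a - x 0 a| <= `|x - p|.
  by rewrite distrC; apply: le_trans (le_coord_norm _ a); rewrite !mxE.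
pose pi x := Phi (p 0 a - x 0 a) x.
pose w' x := w (pi x).
have piV x : W x -> V (pi x).
  rewrite WE => xp; apply: (dPhi _ _ _ xp).1.
  exact: le_lt_trans (time_lt x) xp.
have Cpi j : smooth_on W (fun x => pi x 0 j).
  move=> k; pose G x : 'rV[R]_(1 + n) := row_mx (const_mx (p 0 a - x 0 a)) x.
  pose O := [set z : 'rV[R]_(1 + n) | `|z - row_mx 0 p| < rho].
  have oO : open O.
    rewrite (_ : O = ball (row_mx 0 p : 'rV[R]_(1 + n)) rho); first exact: ball_open.
    by apply/seteqP; split => z; rewrite /O -ball_normE/= distrC.
  have GO x : W x -> O (G x).
    rewrite WE /O/= => xp; have -> : G x - row_mx 0 p =
      row_mx (const_mx (p 0 a - x 0 a)) (x - p).
      by rewrite /G opp_row_mx add_row_mx oppr0 addr0.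
    apply: norm_rV_lt => // i; case: (split_ordP i) => b ->.
      by rewrite row_mxEl mxE; exact: le_lt_trans (time_lt x) xp.
    by rewrite row_mxEr; exact: le_lt_trans (le_coord_norm _ _) xp.
  have C1 := (Ck_on_rV k _ oO).1 (CPhi k) j.
  have C2 i : Ck_on k W (fun x => G x 0 i).
    case: (split_ordP i) => b ->.
      have -> : (fun x => G x 0 (lshift n b)) = fun x => p 0 a + - x 0 a.
        by apply/funext => x; rewrite row_mxEl mxE.
      apply: (Ck_onD oW); first exact: Ck_on_cst.
      by apply: (Ck_onN oW); exact: Ck_on_coord.
    have -> : (fun x => G x 0 (rshift 1 b)) = fun x => x 0 b.
      by apply/funext => x; rewrite row_mxEr.
    exact: Ck_on_coord.
  have := Ck_on_comp oW oO GO C1 C2; apply: (Ck_on_eq oW) => x _.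
  by rewrite /pi /G row_mxEl mxE row_mxKr.
have Cw' : smooth_on W w'.
  by move=> k; apply: (Ck_on_comp oW oV piV (Cw k)) => j; exact: Cpi.
have Phi_W s x : `|s| < rho -> (1 + B) * `|x - p| < rho -> `|s| <= `|x - p| ->
    W (Phi s x).
  move=> sr xr sx; rewrite WE -(subrKA x); apply: le_lt_trans (ler_normD _ _) _.
  by have := Phi_le s x sr; have := ler_wpM2l B0 sx; lra.
(* [Z] moves the coordinate [a] at unit speed, so after time [s] the slice is [s] closer in time and
   the group law gives the same endpoint. Hence [w'] is constant along the flow. *)
have pi_flow s x : W x -> `|s| < rho -> `|p 0 a - x 0 a - s| < rho ->
    pi (Phi s x) = pi x.
  move=> Wx sr tr; rewrite /pi (Phi_coord a 1)// mul1r opprD addrA PhiD//.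
  by rewrite [s + _]addrC subrK.
have Zw' x : W x -> vf_app Z w' x = 0.
  move=> Wx; have xp : `|x - p| < rho by rewrite -WE.
  have r0 : `|0 : R| < rho by rewrite normr0.
  have dc := (dPhi 0 x r0 xp).2; rewrite Phi0 in dc.
  have dw : differentiable w' (Phi 0 x).
    by rewrite Phi0; exact: Ck_on_differentiable oW (Cw' 1%N) Wx.
  have [_] := comp_curve dw dc; rewrite Phi0 /vf_app => <-.
  rewrite -[RHS](derive_cst (w' x) (0 : R) (1 : R)).
  apply: near_eq_derive.
  have d0 : 0 < rho - `|x - p| by rewrite subr_gt0.
  have := near_dist_lt (0 : R^o) d0; apply: filterS => s; rewrite subr0 => sd.
  rewrite /w' pi_flow//; first by have := normr_ge0 (x - p); lra.
  apply: le_lt_trans (ler_normB _ _) _; have := time_lt x; lra.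
(* From [x] the slice is reached in time at most [|x - p|], over a distance at most [B * |x - p|];
   within [r2] of [p] the whole trajectory therefore stays in [W]. *)
pose r2 := rho / (1 + B).
have B1 : 0 < 1 + B by rewrite ltr_pwDl.
have r20 : 0 < r2 by rewrite divr_gt0.
have r2r : r2 <= rho by rewrite ler_pdivrMr// ler_peMr ?lerDl// ltW.
pose V' : set 'rV[R]_n := ball p r2.
have V'E x : V' x = (`|x - p| < r2) by rewrite /V' -ball_normE/= distrC.
have V'W : V' `<=` W by move=> x; rewrite V'E WE => /lt_le_trans; apply.
exists V', w', pi; split.
- by split; [exact: ball_open|exact: ballxx|exact: subset_trans WV].
- by move=> k; exact: Ck_on_sub (Cw' k).
- by move=> x /V'W; exact: Zw'.
- by move=> x _ xa; rewrite /w' /pi xa subrr Phi0.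
move=> x V'x; have Wx := V'W _ V'x.
have xr : (1 + B) * `|x - p| < rho.
  by rewrite mulrC -ltr_pdivlMr// -/r2 -V'E.
have xp : `|x - p| < rho by rewrite -WE.
pose T := p 0 a - x 0 a.
have Tr : `|T| < rho by exact: le_lt_trans (time_lt x) xp.
have pa : pi x 0 a = p 0 a by rewrite /pi (Phi_coord a 1)// mul1r subrKC.
split => //.
- exact: piV.
- by move=> j Zj; rewrite /pi (Phi_coord j 0)// mul0r addr0.
move=> Y CY Ya ZY Ypi.
have CYW j : smooth_on W (fun x => Y x 0 j) by move=> k; exact: Ck_on_sub WV (CY j k).
have CZW j : smooth_on W (fun x => Z x 0 j) by move=> k; exact: Ck_on_sub WV (CZ j k).
have Cg := smooth_vf_app oW CYW Cw'.
have Zg z : W z -> vf_app Z (vf_app Y w') z = 0.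
  move=> Wz; have := bracket_apply oW CZW CYW Cw' Wz.
  rewrite {1}/vf_app ZY ?derive0; last exact: WV.
  have -> : vf_app Y (vf_app Z w') z = 0.
    rewrite {1}/vf_app -[RHS](derive_cst (0 : R) z (Y z)).
    by apply: near_eq_derive; apply: (near_open oW Wz) => y /Zw'.
  by rewrite subr0.
have dk (s : R) : `|s| <= `|T| -> is_derive s 1 (fun s => vf_app Y w' (Phi s x)) 0.
  move=> sT; have sr := le_lt_trans sT Tr.
  have Ws : W (Phi s x) by apply: Phi_W => //; exact: le_trans (time_lt x).
  have dg := Ck_on_differentiable oW (Cg 1%N) Ws.
  exact: is_derive_eq (comp_curve dg (dPhi s x sr xp).2) (Zg _ Ws).
have [s _] := MVT_sym dk; rewrite mul0r Phi0 => /subr0_eq <-.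
(* The line through [pi x] in the direction [Y (pi x)] stays in the slice, where the flow time is 0
   and [pi] is the identity. *)
rewrite -[Phi T x]/(pi x) -Ypi /vf_app; apply: derive_along_line => h.
by rewrite /w' {1}/pi !mxE pa Ya ?mulr0 ?add0r ?subrr ?Phi0//; exact: piV.
Qed.

End FirstIntegrals.

(** * Successive projections along a commuting frame *)

Section CommutingFrame.
Context {R : realType} {n r : nat}.
Variables (V : set 'rV[R]_n) (p : 'rV[R]_n) (Z : 'I_r -> 'rV[R]_n -> 'rV[R]_n)
  (sigma : 'I_r -> 'I_n) (w0 : 'rV[R]_n -> R).
Hypotheses (oV : open V) (Vp : V p)
  (CZ : forall i j, smooth_on V (fun x => Z i x 0 j))
  (Z_sigma : forall i j x, V x -> Z i x 0 (sigma j) = (i == j)%:R)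
  (Z_comm : forall i j x, V x -> lie_bracket (Z i) (Z j) x = 0)
  (Cw0 : smooth_on V w0).

(* Induction on [k]: [w] is annihilated by the first [k] fields along the slice
   where the coordinates [sigma l], [l >= k], are frozen at [p]. *)
Lemma partial_first_integral (k : nat) : (k <= r)%N ->
  exists (W : set 'rV[R]_n) (w : 'rV[R]_n -> R),
  [/\ [/\ open W, W p & W `<=` V], smooth_on W w,
    forall x, W x ->
      (forall l : 'I_r, (k <= l)%N -> x 0 (sigma l) = p 0 (sigma l)) ->
      forall i : 'I_r, (i < k)%N -> vf_app (Z i) w x = 0 &
    forall x, W x -> (forall l, x 0 (sigma l) = p 0 (sigma l)) -> w x = w0 x].
Proof.
elim: k => [_|k IH kr].
  by exists V, w0; split => //; split.
have [W [w [[oW Wp WV] Cw w_inv w_init]]] := IH (ltnW kr).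
pose ik := Ordinal kr.
have CZW i j : smooth_on W (fun x => Z i x 0 j).
  by move=> l; exact: Ck_on_sub WV (CZ i j l).
have Z1 x : W x -> Z ik x 0 (sigma ik) = 1.
  by move=> /WV Vx; rewrite Z_sigma// eqxx.
have [W' [w' [pi [[oW' W'p W'W] Cw' Zw' w'_init w'_pi]]]] :=
  project_along_flow oW Wp (CZW ik) Z1 Cw.
exists W', w'; split => //.
- by split => //; exact: subset_trans WV.
- move=> x W'x xl i; rewrite ltnS leq_eqVlt => /orP[/eqP ik_eq|ik_lt].
    by have -> : i = ik; [exact: val_inj|exact: Zw'].
  have [Wpi pi_k pi_l H] := w'_pi _ W'x.
  have nik : i != ik by rewrite -val_eqE/= neq_ltn ik_lt.
  apply: (H (Z i) (CZW i)).
  + by move=> z /WV Vz; rewrite Z_sigma// (negbTE nik).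
  + by move=> z /WV; exact: Z_comm.
  (* The induction hypothesis applies at the projected point: the coordinate [sigma ik] has just
     been frozen by the projection, and the flow of [Z ik] does not move the later ones. *)
  apply: w_inv => // l kl; have [->|lk] := eqVneq l ik; first exact: pi_k.
  rewrite pi_l; last by move=> z /WV Vz; rewrite Z_sigma// eq_sym (negbTE lk).
  by apply: xl; rewrite ltn_neqAle kl andbT -[k]/(val ik) val_eqE eq_sym.
- by move=> x W'x xl; rewrite w'_init// w_init//; exact: W'W.
Qed.

Lemma local_first_integral :
  exists (W : set 'rV[R]_n) (w : 'rV[R]_n -> R),
  [/\ [/\ open W, W p & W `<=` V], smooth_on W w,
    forall i x, W x -> vf_app (Z i) w x = 0 &
    forall x, W x -> (forall l, x 0 (sigma l) = p 0 (sigma l)) -> w x = w0 x].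
Proof.
have [W [w [HW Cw w_inv w_init]]] := partial_first_integral (leqnn r).
exists W, w; split => // i x Wx; apply: w_inv => // l.
by rewrite leqNgt ltn_ord.
Qed.

End CommutingFrame.

(** * Lie brackets and modules of vector fields *)

Section BracketAlgebra.
Context {R : realType} {n : nat}.
Implicit Types (U V : set 'rV[R]_n) (X Y : 'rV[R]_n -> 'rV[R]_n)
  (f g : 'rV[R]_n -> R) (x : 'rV[R]_n).

Lemma smooth_on_rV m U (X : 'rV[R]_n -> 'rV[R]_m) : open U ->
  smooth_on U X <-> forall j, smooth_on U (fun x => X x 0 j).
Proof.
move=> oU; split=> [CX j k|CX k]; first exact: (Ck_on_rV k _ oU).1.
by apply/(Ck_on_rV k _ oU) => j; exact: CX.
Qed.

Lemma smooth_onM U f g : open U -> smooth_on U f -> smooth_on U g ->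
  smooth_on U (fun x => f x * g x).
Proof. by move=> oU Cf Cg k; exact: Ck_onM. Qed.

Lemma smooth_sum U (I : finType) (P : pred I) (f : I -> 'rV[R]_n -> R) : open U ->
  (forall i, smooth_on U (f i)) -> smooth_on U (fun x => \sum_(i | P i) f i x).
Proof. by move=> oU Cf k; apply: Ck_on_sum => // i; exact: Cf. Qed.

Lemma smooth_comb U r (a : 'I_r -> 'rV[R]_n -> R) (Z : 'I_r -> 'rV[R]_n -> 'rV[R]_n) :
  open U -> (forall i, smooth_on U (a i)) -> (forall i, smooth_on U (Z i)) ->
  smooth_on U (fun x => \sum_i a i x *: Z i x).
Proof.
move=> oU Ca CZ; apply/smooth_on_rV => // j.
have H : smooth_on U (fun x => \sum_i a i x * Z i x 0 j).
  by apply: smooth_sum => // i; apply: smooth_onM => //; exact: (smooth_on_rV _ oU).1.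
move=> k; apply: (Ck_on_eq oU _ (H k)) => x _.
by rewrite summxE; apply: eq_bigr => i _; rewrite mxE.
Qed.

Lemma lie_bracketE U X Y x j : open U -> smooth_on U X -> smooth_on U Y -> U x ->
  lie_bracket X Y x 0 j =
  'D_(X x) (fun y => Y y 0 j) x - 'D_(Y x) (fun y => X y 0 j) x.
Proof.
move=> oU CX CY Ux.
have dX v := @smooth_vf_derive _ _ U X v x oU ((smooth_on_rV X oU).1 CX) Ux.
have dY v := @smooth_vf_derive _ _ U Y v x oU ((smooth_on_rV Y oU).1 CY) Ux.
by rewrite /lie_bracket (derive_mx (dX _)) (derive_mx (dY _)) !mxE.
Qed.

Lemma lie_bracketN X Y x : lie_bracket Y X x = - lie_bracket X Y x.
Proof. by rewrite /lie_bracket opprB. Qed.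

Lemma lie_bracket_self X x : lie_bracket X X x = 0.
Proof. by rewrite /lie_bracket subrr. Qed.

Lemma lie_bracket_eq U X X' Y Y' x : open U -> U x ->
  (forall y, U y -> X y = X' y) -> (forall y, U y -> Y y = Y' y) ->
  lie_bracket X Y x = lie_bracket X' Y' x.
Proof.
move=> oU Ux XX' YY'; rewrite /lie_bracket (XX' x Ux) (YY' x Ux).
by congr (_ - _); apply: near_eq_derive; exact: near_open oU Ux _.
Qed.

Lemma derive_dir_comb U f r (a : 'I_r -> R) (v : 'I_r -> 'rV[R]_n) x :
  open U -> smooth_on U f -> U x ->
  'D_(\sum_i a i *: v i) f x = \sum_i a i * 'D_(v i) f x.
Proof.
move=> oU Cf Ux; have df := Ck_on_differentiable oU (Cf 1%N) Ux.
rewrite (deriveE _ df) linear_sum; apply: eq_bigr => i _.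
by rewrite linearZ/= (deriveE _ df).
Qed.

Lemma lie_bracket_comb U X r (b : 'I_r -> 'rV[R]_n -> R)
    (Z : 'I_r -> 'rV[R]_n -> 'rV[R]_n) x :
  open U -> smooth_on U X -> (forall i, smooth_on U (b i)) ->
  (forall i, smooth_on U (Z i)) -> U x ->
  lie_bracket X (fun y => \sum_i b i y *: Z i y) x =
  \sum_i (b i x *: lie_bracket X (Z i) x + vf_app X (b i) x *: Z i x).
Proof.
move=> oU CX Cb CZ Ux; apply/rowP => k.
have CXk := (smooth_on_rV X oU).1 CX k.
have CZk i := (smooth_on_rV (Z i) oU).1 (CZ i) k.
rewrite (lie_bracketE k oU CX (smooth_comb oU Cb CZ) Ux) summxE.
rewrite (derive_dir_comb _ _ oU CXk Ux).
have -> : (fun y => (\sum_i b i y *: Z i y) 0 k) = fun y => \sum_i b i y * Z i y 0 k.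
  by apply/funext => y; rewrite summxE; apply: eq_bigr => i _; rewrite mxE.
rewrite (@derive_sum_mul _ _ U _ b (fun i y => Z i y 0 k) _ _ oU Cb CZk Ux).
rewrite -sumrB; apply: eq_bigr => i _.
rewrite [RHS]mxE [X in _ = X + _]mxE [X in _ = _ + X]mxE.
rewrite (lie_bracketE k oU CX (CZ i) Ux) /vf_app.
move: ('D_(X x) (b i) x) ('D_(X x) _ x) ('D_(Z i x) _ x) => A B C; ring.
Qed.

Lemma lie_bracketZl U f X Y x : open U -> smooth_on U f -> smooth_on U X ->
  smooth_on U Y -> U x ->
  lie_bracket (fun y => f y *: X y) Y x =
  f x *: lie_bracket X Y x - vf_app Y f x *: X x.
Proof.
move=> oU Cf CX CY Ux; rewrite lie_bracketN.
have := @lie_bracket_comb U Y 1 (fun=> f) (fun=> X) x oU CY (fun=> Cf) (fun=> CX) Ux.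
rewrite big_ord1 (_ : (fun y => \sum_(i < 1) f y *: X y) = fun y => f y *: X y); last first.
  by apply/funext => y; rewrite big_ord1.
by move=> ->; rewrite opprD (lie_bracketN X Y) scalerN opprK.
Qed.

Section Modules.
Variables (U : set 'rV[R]_n) (r : nat) (Z : 'I_r -> 'rV[R]_n -> 'rV[R]_n).
Hypotheses (oU : open U) (CZ : forall i, smooth_on U (Z i)).

Lemma in_module_eq X Y : (forall x, U x -> X x = Y x) ->
  in_module U Z X -> in_module U Z Y.
Proof.
by move=> XY [c [Cc Xc]]; exists c; split => // x Ux; rewrite -XY// Xc.
Qed.

Lemma in_module_gen i : in_module U Z (Z i).
Proof.
exists (fun j _ => (j == i)%:R); split; first by move=> j k; exact: Ck_on_cst.
move=> x _; rewrite (bigD1 i)//= eqxx scale1r big1 ?addr0// => j /negbTE ->.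
by rewrite scale0r.
Qed.

Lemma in_moduleZ f X : smooth_on U f -> in_module U Z X ->
  in_module U Z (fun x => f x *: X x).
Proof.
move=> Cf [c [Cc Xc]]; exists (fun i x => f x * c i x); split.
  by move=> i; exact: smooth_onM.
move=> x Ux; rewrite Xc// scaler_sumr; apply: eq_bigr => i _.
by rewrite scalerA.
Qed.

Lemma in_module_sum (I : finType) (X : I -> 'rV[R]_n -> 'rV[R]_n) :
  (forall i, in_module U Z (X i)) -> in_module U Z (fun x => \sum_i X i x).
Proof.
move=> /choice[c Hc]; exists (fun j x => \sum_i c i j x); split.
  by move=> j; apply: smooth_sum => // i; exact: (Hc i).1.
move=> x Ux; under [RHS]eq_bigr do rewrite scaler_suml.
by rewrite exchange_big; apply: eq_bigr => i _; rewrite (Hc i).2.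
Qed.

Lemma in_moduleD X Y : in_module U Z X -> in_module U Z Y ->
  in_module U Z (fun x => X x + Y x).
Proof.
move=> [c [Cc Xc]] [d [Cd Yd]]; exists (fun i x => c i x + d i x); split.
  by move=> i k; apply: Ck_onD => //; [exact: Cc|exact: Cd].
move=> x Ux; rewrite Xc// Yd// -big_split; apply: eq_bigr => i _.
by rewrite scalerDl.
Qed.

Lemma in_moduleN X : in_module U Z X -> in_module U Z (fun x => - X x).
Proof.
move=> HX; have := in_moduleZ (fun k => Ck_on_cst k U (-1 : R)) HX.
by apply: in_module_eq => x _; rewrite scaleN1r.
Qed.

Lemma lie_bracket_comb_in_module X (b : 'I_r -> 'rV[R]_n -> R) : smooth_on U X ->
  (forall i, smooth_on U (b i)) -> (forall i, in_module U Z (lie_bracket X (Z i))) ->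
  in_module U Z (lie_bracket X (fun y => \sum_i b i y *: Z i y)).
Proof.
move=> CX Cb HX.
apply: (@in_module_eq (fun x =>
  \sum_i (b i x *: lie_bracket X (Z i) x + vf_app X (b i) x *: Z i x))).
  by move=> x Ux; rewrite (lie_bracket_comb oU CX Cb CZ Ux).
apply: (@in_module_sum _ (fun i x =>
  b i x *: lie_bracket X (Z i) x + vf_app X (b i) x *: Z i x)) => i.
apply: in_moduleD; first exact: in_moduleZ.
apply: in_moduleZ; last exact: in_module_gen.
by apply: smooth_vf_app => //; exact/smooth_on_rV.
Qed.

(** Bracketing is a derivation in each argument. Expanding one argument, then the other through
    antisymmetry, leaves brackets of generators and generators multiplied by derivatives of
    coefficients. *)
Lemma involutive_of_generators :
  (forall i j, in_module U Z (lie_bracket (Z i) (Z j))) -> involutive_on U Z.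
Proof.
move=> HZ X Y [a [Ca Xa]] [b [Cb Yb]].
have CX := smooth_comb oU Ca CZ.
apply: (@in_module_eq (lie_bracket (fun y => \sum_i a i y *: Z i y)
                                   (fun y => \sum_i b i y *: Z i y))).
  by move=> x Ux; apply: (lie_bracket_eq oU Ux) => y Uy; [rewrite Xa|rewrite Yb].
apply: lie_bracket_comb_in_module => // i.
apply: (@in_module_eq (fun x => - lie_bracket (Z i) (fun y => \sum_j a j y *: Z j y) x)).
  by move=> x _; rewrite lie_bracketN opprK.
by apply: in_moduleN; exact: lie_bracket_comb_in_module.
Qed.

End Modules.

Lemma in_module_sub U V r (Z : 'I_r -> 'rV[R]_n -> 'rV[R]_n) X : V `<=` U ->
  in_module U Z X -> in_module V Z X.
Proof.
move=> VU [c [Cc Xc]]; exists c; split; last by move=> x /VU; exact: Xc.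
by move=> i k; exact: Ck_on_sub VU (Cc i k).
Qed.

Lemma smooth_on_sub (E : normedModType R) U V (F : 'rV[R]_n -> E) : V `<=` U ->
  smooth_on U F -> smooth_on V F.
Proof. by move=> VU CF k; exact: Ck_on_sub VU (CF k). Qed.

(** Members of the module on [V] have coefficients that need not extend to [U], so involutivity does
    not restrict directly; the generators do come from [U]. *)
Lemma involutive_sub U V r (Z : 'I_r -> 'rV[R]_n -> 'rV[R]_n) :
  open U -> open V -> V `<=` U -> (forall i, smooth_on U (Z i)) ->
  involutive_on U Z -> involutive_on V Z.
Proof.
move=> oU oV VU CZ HZ; apply: involutive_of_generators => //.
  by move=> i; exact: smooth_on_sub VU (CZ i).
move=> i j; apply: in_module_sub VU _.
by apply: HZ; exact: in_module_gen.
Qed.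

End BracketAlgebra.

(** * Normalizing the frame *)

Section NormalizedFrame.
Context {R : realType} {n : nat}.
Implicit Types (U V : set 'rV[R]_n) (X Y : 'rV[R]_n -> 'rV[R]_n)
  (f g : 'rV[R]_n -> R) (x p : 'rV[R]_n).

Lemma smooth_det U r (A : 'rV[R]_n -> 'M[R]_r) : open U ->
  (forall i j, smooth_on U (fun x => A x i j)) -> smooth_on U (fun x => \det (A x)).
Proof.
move=> oU CA; apply: smooth_sum => // s; apply: smooth_onM => //.
  by move=> k; exact: Ck_on_cst.
by move=> k; apply: Ck_on_prod => // i; exact: CA.
Qed.

(** Cramer's formula: each entry is a cofactor divided by the determinant. *)
Lemma smooth_invmx U r (A : 'rV[R]_n -> 'M[R]_r) i j : open U ->
  (forall i j, smooth_on U (fun x => A x i j)) ->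
  (forall x, U x -> \det (A x) != 0) -> smooth_on U (fun x => invmx (A x) i j).
Proof.
move=> oU CA dA.
have H : smooth_on U (fun x => (\det (A x))^-1 *
    ((-1) ^+ (j + i) * \det (row' j (col' i (A x))))).
  apply: smooth_onM => //; first by move=> k; apply: Ck_onV => //; exact: smooth_det.
  apply: smooth_onM => //; first by move=> k; exact: Ck_on_cst.
  apply: smooth_det => // a b k; have := CA (lift j a) (lift i b) k.
  by apply: Ck_on_eq => // x _; rewrite !mxE.
move=> k; apply: (Ck_on_eq oU _ (H k)) => x Ux.
by rewrite /invmx unitmxE unitfE dA// !mxE.
Qed.

Lemma row_comb r (Z : 'I_r -> 'rV[R]_n) (u : 'rV[R]_r) :
  u *m (\matrix_(i < r) Z i) = \sum_i u 0 i *: Z i.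
Proof. by rewrite mulmx_sum_row; apply: eq_bigr => i _; rewrite rowK. Qed.

Lemma row_free_combP r (Z : 'I_r -> 'rV[R]_n) :
  row_free (\matrix_(i < r) Z i) <->
  forall u : 'I_r -> R, \sum_i u i *: Z i = 0 -> forall i, u i = 0.
Proof.
split=> [fZ u u0 i|H].
  have : (\row_i u i) *m (\matrix_(i < r) Z i) = 0.
    by rewrite row_comb -[RHS]u0; apply: eq_bigr => j _; rewrite mxE.
  by move/eqP; rewrite mulmx_free_eq0// => /eqP/rowP/(_ i); rewrite !mxE.
rewrite -kermx_eq0; apply/eqP/row_matrixP => i; rewrite row0; apply/rowP => j.
rewrite [RHS]mxE; apply: (H (fun j => row i (kermx (\matrix_(i < r) Z i)) 0 j)).
by rewrite -row_comb -row_mul mulmx_ker row0.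
Qed.

Lemma free_columns r (M : 'M[R]_(r, n)) : row_free M ->
  exists sigma : 'I_r -> 'I_n, \det (\matrix_(i, j) M i (sigma j)) != 0.
Proof.
move=> fM; have fMt : row_full M^T by rewrite /row_full mxrank_tr.
exists (fullrankfun fMt); rewrite -unitfE -unitmxE -unitmx_tr.
have := fullrowsub_unit fMt; congr (_ \in unitmx).
by apply/matrixP => i j; rewrite !mxE.
Qed.

(* The frame is normalized by inverting a block of [Z]; the new brackets lie in
   the span of the frame and have vanishing [sigma]-components. *)
Lemma normalized_frame U r (Z : 'I_r -> 'rV[R]_n -> 'rV[R]_n) p :
  open U -> involutive_distribution U Z -> U p ->
  exists (V : set 'rV[R]_n) (sigma : 'I_r -> 'I_n)
    (Z' : 'I_r -> 'rV[R]_n -> 'rV[R]_n),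
  [/\ [/\ open V, V p & V `<=` U], forall i, smooth_on V (Z' i),
    forall i j x, V x -> Z' i x 0 (sigma j) = (i == j)%:R,
    forall i j x, V x -> lie_bracket (Z' i) (Z' j) x = 0 &
    [/\ forall i x, V x -> Z i x = \sum_j Z i x 0 (sigma j) *: Z' j x &
        forall i, exists b : 'I_r -> 'rV[R]_n -> R,
          forall x, V x -> Z' i x = \sum_k b k x *: Z k x]].
Proof.
move=> oU [CZ fZ iZ] Up.
have [sigma det_p] := free_columns (fZ p Up).
pose A x : 'M[R]_r := \matrix_(i, j) Z i x 0 (sigma j).
have CA i j : smooth_on U (fun x => A x i j).
  move=> k; have := (smooth_on_rV (Z i) oU).1 (CZ i) (sigma j) k.
  by apply: Ck_on_eq => // x _; rewrite mxE.
have Cdet := smooth_det oU CA.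
have det_p' : \det (A p) != 0.
  apply: contra det_p => /eqP <-; apply/eqP; congr (\det _).
  by apply/matrixP => i j; rewrite !mxE.
have : \forall x \near p, U x /\ \det (A x) != 0.
  near=> x; split; first by near: x; exact: open_nbhs_nbhs.
  rewrite -normr_gt0; near: x.
  apply: (cvgr_norm_gt (\det (A p))); last by rewrite normr_gt0.
  exact: Ck_on_continuous (Cdet 0%N) _ Up.
move=> /nbhs0_normP[d d0 Hd].
pose V : set 'rV[R]_n := ball p d.
have VE x : V x -> `|x - p| < d by rewrite /V -ball_normE/= distrC.
have oV : open V by exact: ball_open.
have VU : V `<=` U by move=> x /VE/Hd[].
have dA x : V x -> \det (A x) != 0 by move=> /VE/Hd[].
have uA x : V x -> A x \in unitmx by move=> Vx; rewrite unitmxE unitfE dA.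
pose b i k x := invmx (A x) i k.
have Cb i k : smooth_on V (b i k).
  by apply: smooth_invmx => // a c; exact: smooth_on_sub VU (CA a c).
pose Z' i x := \sum_k b i k x *: Z k x.
have CZV i : smooth_on V (Z i) by exact: smooth_on_sub VU (CZ i).
have CZ' i : smooth_on V (Z' i) by exact: smooth_comb.
have Z'_sigma i j x : V x -> Z' i x 0 (sigma j) = (i == j)%:R.
  move=> Vx; have := mulVmx (uA x Vx) => /matrixP/(_ i j).
  rewrite [in RHS]mxE => <-; rewrite mxE summxE; apply: eq_bigr => k _.
  by rewrite mxE [A x k j]mxE.
have ZE i x : V x -> Z i x = \sum_j Z i x 0 (sigma j) *: Z' j x.
  move=> Vx.
  rewrite /Z'; under eq_bigr do rewrite scaler_sumr.
  rewrite exchange_big/= (bigD1 i)//= [X in _ + X]big1 ?addr0; last first.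
    move=> k ki; under eq_bigr do rewrite scalerA.
    rewrite -scaler_suml; have := mulmxV (uA x Vx) => /matrixP/(_ i k).
    rewrite !mxE eq_sym (negbTE ki) => E.
    rewrite (_ : \sum_i0 _ = 0) ?scale0r// -[RHS]E; apply: eq_bigr => j _.
    by rewrite mxE.
  under eq_bigr do rewrite scalerA.
  rewrite -scaler_suml; have := mulmxV (uA x Vx) => /matrixP/(_ i i).
  rewrite !mxE eqxx => E; rewrite (_ : \sum_i0 _ = 1) ?scale1r// -[RHS]E.
  by apply: eq_bigr => j _; rewrite mxE.
exists V, sigma, Z'; split => //.
- by split => //; exact: ballxx.
- move=> i j x Vx.
  have iZV := involutive_sub oU oV VU CZ iZ.
  have mZ' k : in_module V Z (Z' k) by exists (b k).
  have [c [_ /(_ x Vx) E]] := iZV _ _ (mZ' i) (mZ' j).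
  pose e l := \sum_k c k x * Z k x 0 (sigma l).
  have E' : lie_bracket (Z' i) (Z' j) x = \sum_l e l *: Z' l x.
    rewrite E; under eq_bigr => k _ do rewrite (ZE k x Vx) scaler_sumr.
    rewrite exchange_big; apply: eq_bigr => l _; rewrite /e scaler_suml.
    by apply: eq_bigr => k _; rewrite scalerA.
  rewrite E' big1// => l _.
  suff -> : e l = 0 by rewrite scale0r.
  (* The [sigma]-components of the new frame are constant functions, so their derivatives vanish; by
     the expansion [E'] this component of the bracket is [e l]. *)
  have : lie_bracket (Z' i) (Z' j) x 0 (sigma l) = 0.
    rewrite (lie_bracketE _ oV (CZ' i) (CZ' j) Vx).
    have D0 k v : 'D_v (fun y => Z' k y 0 (sigma l)) x = 0.
      rewrite -[RHS](derive_cst ((k == l)%:R : R) x v); apply: near_eq_derive.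
      by apply: (near_open oV Vx) => y Vy; exact: Z'_sigma.
    by rewrite !D0 subrr.
  rewrite E' summxE (bigD1 l)//= mxE Z'_sigma// eqxx mulr1 big1 ?addr0//.
  by move=> k kl; rewrite mxE Z'_sigma// (negbTE kl) mulr0.
- by split => // i; exists (b i).
Unshelve. all: by end_near. Qed.

End NormalizedFrame.

(** * Symmetries *)

Section Symmetries.
Context {R : realType} {n r : nat}.
Implicit Types (U V : set 'rV[R]_n) (X Y : 'rV[R]_n -> 'rV[R]_n)
  (f g : 'rV[R]_n -> R) (x p : 'rV[R]_n) (Z : 'I_r -> 'rV[R]_n -> 'rV[R]_n)
  (lam : 'I_r -> 'rV[R]_n -> R) (c : 'I_r -> 'I_r -> 'rV[R]_n -> R).

Lemma adjoin_max Z X : adjoin Z X ord_max = X.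
Proof. by rewrite /adjoin unlift_none. Qed.

Lemma adjoin_lift Z X i : adjoin Z X (lift ord_max i) = Z i.
Proof. by rewrite /adjoin liftK. Qed.

Lemma sum_adjoin Z X (u : 'I_r.+1 -> R) x :
  \sum_i u i *: adjoin Z X i x =
  u ord_max *: X x + \sum_k u (lift ord_max k) *: Z k x.
Proof.
rewrite (bigD1_ord ord_max)//= adjoin_max; congr (_ + _).
by apply: eq_bigr => k _; rewrite adjoin_lift.
Qed.

Lemma smooth_adjoin U Z X : (forall i, smooth_on U (Z i)) -> smooth_on U X ->
  forall i, smooth_on U (adjoin Z X i).
Proof. by move=> CZ CX i; rewrite /adjoin; case: unliftP. Qed.

Lemma in_module_adjoin U Z X Y : in_module U Z Y -> in_module U (adjoin Z X) Y.
Proof.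
move=> [c [Cc Yc]].
exists (fun i x => if unlift ord_max i is Some k then c k x else 0); split.
  by move=> i; case: unliftP => [k|] _ //; move=> k; exact: Ck_on_cst.
move=> x Ux; rewrite sum_adjoin unlift_none scale0r add0r Yc//.
by apply: eq_bigr => k _; rewrite liftK.
Qed.

Lemma in_module_adjoin_max U Z X : open U -> in_module U (adjoin Z X) X.
Proof.
by move=> oU; have := @in_module_gen _ _ U _ (adjoin Z X) ord_max; rewrite adjoin_max.
Qed.

Lemma in_module_gen_adjoin U Z X i : in_module U (adjoin Z X) (Z i).
Proof. by apply: in_module_adjoin; exact: in_module_gen. Qed.

Lemma independent_adjoin U Z X x : independent_on U (adjoin Z X) -> U x ->
  forall (a : R) (u : 'I_r -> R), a *: X x + \sum_k u k *: Z k x = 0 ->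
  a = 0 /\ forall k, u k = 0.
Proof.
move=> iX Ux a u E.
have /(row_free_combP (fun i => adjoin Z X i x))H := iX x Ux.
pose v i := if unlift ord_max i is Some k then u k else a.
have Hv : \sum_i v i *: adjoin Z X i x = 0.
  rewrite sum_adjoin /v unlift_none -[RHS]E; congr (_ + _).
  by apply: eq_bigr => k _; rewrite liftK.
have {}H := H _ Hv; split; first by have := H ord_max; rewrite /v unlift_none.
by move=> k; have := H (lift ord_max k); rewrite /v liftK.
Qed.

Lemma independent_adjoin_scale U V Z X f : V `<=` U ->
  independent_on U (adjoin Z X) -> nonvanishing_on V f ->
  independent_on V (adjoin Z (fun x => f x *: X x)).
Proof.
move=> VU iX f0 x Vx; apply/(row_free_combP (fun i => adjoin Z _ i x)) => u.
rewrite sum_adjoin scalerA => /(independent_adjoin iX (VU _ Vx))[u0 uk] i.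
case: (unliftP ord_max i) => [k ->|->]; first exact: uk.
by move/eqP: u0; rewrite mulf_eq0 (negbTE (f0 _ Vx)) orbF => /eqP.
Qed.

Lemma Coo_symmetry_relations U Z X : open U -> Coo_symmetry U Z X ->
  exists lam c, bracket_relations U Z X lam c.
Proof.
move=> oU [CX iX HX].
have /choice[d Hd] (i : 'I_r) : exists d : 'I_r.+1 -> 'rV[R]_n -> R,
    (forall j, smooth_on U (d j)) /\
    forall x, U x -> lie_bracket X (Z i) x = \sum_j d j x *: adjoin Z X j x.
  exact: HX (in_module_adjoin_max _ _ oU) (in_module_gen_adjoin _ _ _ _).
exists (fun i => d i ord_max), (fun i k => d i (lift ord_max k)); split.
- by move=> i; exact: (Hd i).1.
- by move=> i k; exact: (Hd i).1.
- by move=> i x Ux; rewrite (Hd i).2// sum_adjoin.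
Qed.

Lemma bracket_relations_sub U V Z X lam c : V `<=` U ->
  bracket_relations U Z X lam c -> bracket_relations V Z X lam c.
Proof.
move=> VU [Cl Cc E]; split.
- by move=> i; exact: smooth_on_sub VU (Cl i).
- by move=> i k; exact: smooth_on_sub VU (Cc i k).
- by move=> i x /VU; exact: E.
Qed.

(** The bracket of f X with Z_i is f [X, Z_i] - Z_i(f) X, and Z_i(f) = lam_i f cancels the X-term.
    The smaller set [V] is where a local solution [f] lives. *)
Lemma symmetry_of_factor U V Z X f lam c : open U -> open V -> V `<=` U ->
  involutive_distribution U Z -> Coo_symmetry U Z X ->
  bracket_relations V Z X lam c -> smooth_on V f -> nonvanishing_on V f ->
  (forall i x, V x -> vf_app (Z i) f x = lam i x * f x) ->
  is_symmetry V Z (fun x => f x *: X x).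
Proof.
move=> oU oV VU [CZ _ iZ] [CX iX _] [Cl Cc E] Cf f0 Zf.
have CZV i : smooth_on V (Z i) by exact: smooth_on_sub VU (CZ i).
have CXV : smooth_on V X by exact: smooth_on_sub VU CX.
pose Y x := f x *: X x.
have CY : smooth_on V Y.
  have := @smooth_comb _ _ V 1 (fun=> f) (fun=> X) oV (fun=> Cf) (fun=> CXV).
  by move=> C k; apply: (Ck_on_eq oV _ (C k)) => x _; rewrite big_ord1.
have YZ i x : V x -> lie_bracket Y (Z i) x = \sum_k (f x * c i k x) *: Z k x.
  move=> Vx; rewrite (lie_bracketZl oV Cf CXV (CZV i) Vx) E// Zf//.
  rewrite scalerDr scalerA mulrC addrAC subrr add0r scaler_sumr.
  by apply: eq_bigr => k _; rewrite scalerA.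
have YZm i : in_module V Z (lie_bracket Y (Z i)).
  exists (fun k x => f x * c i k x); split; last exact: YZ.
  by move=> k; exact: smooth_onM.
split; last first.
  exists (fun i k x => f x * c i k x); split.
  - by move=> i k; exact: Ck_on_cst.
  - by move=> i k; exact: smooth_onM.
  - by move=> i x Vx; rewrite scale0r add0r YZ.
split=> //; first exact: independent_adjoin_scale VU iX f0.
apply: involutive_of_generators => // [|i j]; first exact: smooth_adjoin.
case: (unliftP ord_max i) => [k ->|->]; case: (unliftP ord_max j) => [l ->|->];
  rewrite ?adjoin_lift ?adjoin_max.
- apply: in_module_adjoin; apply: in_module_sub VU _.
  by apply: iZ; exact: in_module_gen.
- apply: in_module_adjoin.
  apply: (@in_module_eq _ _ _ _ _ (fun x => - lie_bracket Y (Z k) x)).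
    by move=> x _; rewrite -lie_bracketN.
  exact: in_moduleN.
- exact: in_module_adjoin.
- apply: (@in_module_eq _ _ _ _ _ (fun x => 0 *: Y x)).
    by move=> x _; rewrite scale0r lie_bracket_self.
  apply: (in_moduleZ oV (f := fun=> 0)); first by move=> k; exact: Ck_on_cst.
  exact: in_module_adjoin_max.
Qed.

(** The bracket of f X with Z_i is known in two ways, one of them without X-term; by independence
    the coefficients of X can be compared. *)
Lemma factor_equation U Z X f lam c : open U -> involutive_distribution U Z ->
  Coo_symmetry U Z X -> bracket_relations U Z X lam c ->
  symmetrizing_factor U Z X f ->
  forall i x, U x -> vf_app (Z i) f x = lam i x * f x.
Proof.
move=> oU [CZ _ _] [CX iX _] [_ _ E] [Cf _ [_ [c' [_ _ E']]]] i x Ux.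
have := E' i x Ux; rewrite scale0r add0r (lie_bracketZl oU Cf CX (CZ i) Ux) E//.
move=> /eqP; rewrite -subr_eq0 => /eqP H.
have H' : (f x * lam i x - vf_app (Z i) f x) *: X x +
    \sum_k (f x * c i k x - c' i k x) *: Z k x = 0.
  rewrite -[RHS]H scalerBl scalerDr scalerA scaler_sumr.
  under eq_bigr do rewrite scalerBl -scalerA.
  by rewrite sumrB -!addrA; congr (_ + _); rewrite addrCA.
have [/eqP] := independent_adjoin iX Ux H'.
by rewrite subr_eq0 mulrC => /eqP <-.
Qed.

Lemma derive_line (f g : 'rV[R]_n -> R) x v :
  derivable f x v -> derivable g x v ->
  (\forall h \near (0 : R), f (h *: v + x) = g (h *: v + x)) ->
  'D_v f x = 'D_v g x.
Proof.
move=> df dg fg.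
have E (k : 'rV[R]_n -> R) : derivable k x v ->
    'D_v k x = 'D_1 (fun h : R => k (h *: v + x)) 0.
  move=> dk; have dk' : derivable k (0 *: v + x) v by rewrite scale0r add0r.
  by have [_ ->] := is_derive_line dk'; rewrite scale0r add0r.
by rewrite (E f df) (E g dg); exact: near_eq_derive.
Qed.

(* A first integral [w] of the frame with [X w <> 0] at [p]: along [Z] the
   function [X w] is multiplied by [- lam], so [1 / X w] is the solution. *)
Lemma compatible_system U Z X lam c : open U -> involutive_distribution U Z ->
  Coo_symmetry U Z X -> bracket_relations U Z X lam c -> compatible_on U Z lam.
Proof.
move=> oU hZ [CX iX _] [Cl Cc E] p Up; have [CZ _ _] := hZ.
have [V [sigma [Z' [[oV Vp VU] CZ' Z'_sigma Z'_comm [ZE Z'E]]]]] :=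
  normalized_frame oU hZ Up.
(* The part of [X p] transverse to the distribution, normalized to have no [sigma]-coordinates. *)
pose v : 'rV[R]_n := X p - \sum_j X p 0 (sigma j) *: Z' j p.
(* If [v] were 0, [X p] would be a combination of the vectors [Z k p], against independence. *)
have [a va] : exists a, v 0 a != 0.
  apply: contrapT => H; have v0 : v = 0.
    apply/rowP => a; rewrite [RHS]mxE; apply/eqP; apply: contrapT => /negP va.
    by apply: H; exists a.
  have /choice[b Hb] := Z'E.
  have H1 : 1 *: X p + \sum_k (- \sum_j X p 0 (sigma j) * b j k p) *: Z k p = 0.
    rewrite scale1r -[RHS]v0 /v; congr (_ + _).
    under eq_bigr do rewrite scaleNr scaler_suml.
    rewrite sumrN exchange_big; congr (- _); apply: eq_bigr => j _.
    rewrite (Hb j p Vp) scaler_sumr; apply: eq_bigr => k _.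
    by rewrite scalerA.
  have [/eqP] := independent_adjoin iX Up H1.
  by rewrite oner_eq0.
have v_sigma j : v 0 (sigma j) = 0.
  rewrite /v 2!mxE summxE (bigD1 j)//= mxE Z'_sigma// eqxx mulr1.
  rewrite big1 ?addr0 ?subrr// => k kj.
  by rewrite mxE Z'_sigma// (negbTE kj) mulr0.
have CZ'j i j := (smooth_on_rV (Z' i) oV).1 (CZ' i) j.
have Cw0 : smooth_on V (fun x : 'rV[R]_n => x 0 a) by move=> k; exact: Ck_on_coord.
have [W [w [[oW Wp WV] Cw Z'w w_init]]] :=
  local_first_integral oV Vp CZ'j Z'_sigma Z'_comm Cw0.
have WU : W `<=` U by exact: subset_trans VU.
have CZW i : smooth_on W (Z i) by exact: smooth_on_sub WU (CZ i).
have CXW : smooth_on W X by exact: smooth_on_sub WU CX.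
have Zw i x : W x -> vf_app (Z i) w x = 0.
  move=> Wx; rewrite /vf_app (ZE i x (WV _ Wx)).
  rewrite (derive_dir_comb _ _ oW Cw Wx) big1// => j _.
  by rewrite -/(vf_app (Z' j) w x) Z'w// mulr0.
have CXw : smooth_on W (vf_app X w).
  by apply: smooth_vf_app => //; exact/smooth_on_rV.
have dw x : W x -> differentiable w x := Ck_on_differentiable oW (Cw 1%N).
(* [X p] and [v] differ by frame vectors, which annihilate [w], and the line from [p] along [v]
   stays in the slice on which [w] is the coordinate [a]. *)
have Xwp : vf_app X w p != 0.
  have -> : vf_app X w p = 'D_v w p.
    rewrite /vf_app /v !(deriveE _ (dw _ Wp)) linearB linear_sum big1 ?subr0// => j _.
    by rewrite linearZ/= -(deriveE _ (dw _ Wp)) -/(vf_app (Z' j) w p) Z'w// scaler0.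
  have coord_a := is_derive_coord a p v.
  rewrite (@derive_line w (fun x => x 0 a)).
  - by have [_ ->] := coord_a.
  - exact: smooth_derive oW Cw Wp.
  - by case: coord_a.
  - have /nbhs0_normP[d d0 Hd] : \forall x \near p, W x by exact: open_nbhs_nbhs.
    have v1 : 0 < `|v| + 1 by rewrite ltr_wpDl.
    apply/(@nbhs0_normP _ R^o 0); exists (d / (`|v| + 1)); first by rewrite divr_gt0.
    move=> h; rewrite subr0 ltr_pdivlMr// => hd; apply: w_init.
      apply: Hd; rewrite addrK normrZ; apply: le_lt_trans hd.
      by rewrite ler_wpM2l// lerDl.
    by move=> l; rewrite mxE [X in X + _]mxE v_sigma mulr0 add0r.
have : \forall x \near p, W x /\ vf_app X w x != 0.
  near=> x; split; first by near: x; exact: open_nbhs_nbhs.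
  rewrite -normr_gt0; near: x.
  apply: (cvgr_norm_gt (vf_app X w p)); last by rewrite normr_gt0.
  exact: Ck_on_continuous (CXw 0%N) _ Wp.
move=> /nbhs0_normP[d d0 Hd].
pose B : set 'rV[R]_n := ball p d.
have BH x : B x -> W x /\ vf_app X w x != 0.
  by rewrite /B -ball_normE/= distrC; exact: Hd.
have oB : open B by exact: ball_open.
have BW : B `<=` W by move=> x /BH[].
exists B; split => //; [exact: ballxx|exact: subset_trans WU|].
exists (fun x => (vf_app X w x)^-1); split.
- by move=> k; apply: Ck_onV => // [x /BH[]//|]; exact: Ck_on_sub BW (CXw k).
- by move=> x /BH[_]; rewrite invr_eq0.
move=> i x Bx; have [Wx Xw0] := BH x Bx.
have CXW' := (smooth_on_rV X oW).1 CXW.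
have CZW' := (smooth_on_rV (Z i) oW).1 (CZW i).
have := bracket_apply oW CXW' CZW' Cw Wx.
have -> : vf_app X (vf_app (Z i) w) x = 0.
  rewrite {1}/vf_app -[RHS](derive_cst (0 : R) x (X x)).
  by apply: near_eq_derive; apply: (near_open oW Wx) => y /Zw.
rewrite sub0r {1}/vf_app E; last exact: WU.
rewrite (deriveE _ (dw _ Wx)) linearD linearZ linear_sum/= big1 ?addr0; last first.
  move=> k _; rewrite linearZ/= -(deriveE _ (dw _ Wx)) -/(vf_app (Z k) w x) Zw//.
  by rewrite scaler0.
rewrite -(deriveE _ (dw _ Wx)) -/(vf_app X w x) => EZ.
have dXw := smooth_derive (v := Z i x) oW CXw Wx.
rewrite {1}/vf_app deriveV// -/(vf_app (Z i) (vf_app X w) x).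
rewrite -[_ *: _]/(_ * _) mulNr -mulrN -EZ -[_ *: _]/(_ * _) expr2 invfM.
by rewrite mulrCA -mulrA mulVf// mulr1.
Unshelve. all: by end_near. Qed.

End Symmetries.

(** Part (1) is local for the same reason as [compatible_on]: the factor that turns X into a
    symmetry need not exist on all of [U]. In (3) the function [g] is a quotient of two symmetrizing
    factors, which are nonvanishing by definition. *)
Theorem corollary2p2 (R : realType) (n r : nat) (hrn : (r < n)%N)
    (U : set 'rV[R]_n) (hU : open U)
    (Z : 'I_r -> 'rV[R]_n -> 'rV[R]_n)
    (hZ : involutive_distribution U Z) :
  (forall X : 'rV[R]_n -> 'rV[R]_n, Coo_symmetry U Z X ->
     forall p : 'rV[R]_n, U p ->
     exists V : set 'rV[R]_n,
       [/\ open V, V p, V `<=` U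
         & exists (Y : 'rV[R]_n -> 'rV[R]_n) (h : 'rV[R]_n -> R),
             [/\ is_symmetry V Z Y, smooth_on V h
               & forall x, V x -> X x = h x *: Y x]])
  /\
  (forall (X : 'rV[R]_n -> 'rV[R]_n) (lam : 'I_r -> 'rV[R]_n -> R)
      (c : 'I_r -> 'I_r -> 'rV[R]_n -> R),
     Coo_symmetry U Z X -> bracket_relations U Z X lam c ->
     compatible_on U Z lam)
  /\
  (forall (X : 'rV[R]_n -> 'rV[R]_n) (f : 'rV[R]_n -> R),
     Coo_symmetry U Z X -> symmetrizing_factor U Z X f ->
     forall ft : 'rV[R]_n -> R,
       symmetrizing_factor U Z X ft <->
       exists g : 'rV[R]_n -> R,
         [/\ first_integral U Z g, nonvanishing_on U g
           & forall x, U x -> ft x = f x * g x]).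
Proof.
split; [|split].
- move=> X HX p Up; have [lam [c E]] := Coo_symmetry_relations hU HX.
  have [V [oV Vp VU [f [Cf f0 Zf]]]] := compatible_system hU hZ HX E Up.
  exists V; split => //.
  exists (fun x => f x *: X x), (fun x => (f x)^-1); split.
  + apply: (symmetry_of_factor hU oV VU hZ HX _ Cf f0 Zf).
    exact: bracket_relations_sub VU E.
  + by move=> k; apply: Ck_onV.
  + by move=> x Vx; rewrite scalerA mulVf ?scale1r// f0.
- by move=> X lam c HX E; exact: compatible_system hU hZ HX E.
move=> X f HX Hf ft; have [lam [c E]] := Coo_symmetry_relations hU HX.
have Zf := factor_equation hU hZ HX E Hf; have [Cf f0 _] := Hf.
have df (g : 'rV[R]_n -> R) x v : smooth_on U g -> U x -> derivable g x v.
  by move=> Cg; exact: smooth_derive hU Cg.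
split=> [Hft|[g [[Cg Zg] g0 ftE]]].
  have Zft := factor_equation hU hZ HX E Hft; have [Cft ft0 _] := Hft.
  have Cfi : smooth_on U (fun x => (f x)^-1) by move=> k; apply: Ck_onV.
  exists (fun x => ft x * (f x)^-1); split.
  + split; first exact: smooth_onM.
    move=> i x Ux; rewrite /vf_app.
    have := deriveM (df _ _ (Z i x) Cft Ux) (df _ _ (Z i x) Cfi Ux).
    rewrite -[X in X = _ -> _]/('D_(Z i x) (fun x => ft x * (f x)^-1) x) => ->.
    rewrite deriveV ?f0//; last exact: df.
    rewrite -/(vf_app (Z i) f x) -/(vf_app (Z i) ft x) Zf// Zft//.
    rewrite -![_ *: _]/(_ * _); have := f0 x Ux => fx0; by field.
  + by move=> x Ux; rewrite mulf_neq0 ?invr_eq0 ?f0 ?ft0.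
  + by move=> x Ux; rewrite mulrC divfK ?f0.
have Cfg : smooth_on U (fun x => f x * g x) by exact: smooth_onM.
have Cft : smooth_on U ft.
  by move=> k; apply: (Ck_on_eq hU _ (Cfg k)) => x Ux; rewrite ftE.
have ft0 : nonvanishing_on U ft.
  by move=> x Ux; rewrite ftE// mulf_neq0 ?f0 ?g0.
split => //; apply: (symmetry_of_factor hU hU _ hZ HX E Cft ft0) => // i x Ux.
have -> : vf_app (Z i) ft x = 'D_(Z i x) (fun x => f x * g x) x.
  by apply: near_eq_derive; apply: (near_open hU Ux) => y; exact: ftE.
have := deriveM (df _ _ (Z i x) Cf Ux) (df _ _ (Z i x) Cg Ux).
rewrite -[X in X = _ -> _]/('D_(Z i x) (fun x => f x * g x) x) => ->.
rewrite -/(vf_app (Z i) f x) -/(vf_app (Z i) g x) Zf// Zg// ftE//.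
by rewrite scaler0 add0r -[_ *: _]/(_ * _); ring.
Qed.
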